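(* Consider the general Hubbard model of the context and suppose that the basis $\{\varphi^{(u)}\}_{u\in V}$ of $\mathcal H_0$ satisfies conditions B0, B1 and B2. Then: (i) In the subspace with electron number $N_{\rm e}\le N_{\rm d}$, the ground state energy of $H$ is $N_{\rm e}\varepsilon_0$, and every ground state is a linear combination of the states $\Phi_{A,\{m_k\}}$ with $A\subset V$, $|A|=N_{\rm e}$, and admissible $\{m_k\}$. (ii) In the subspace with electron number $N_{\rm e}>N_{\rm d}$, the ground state energy of $H$ is strictly larger than $N_{\rm e}\varepsilon_0$.
   Context: Let $\Lambda$ be a finite set, with fermion operators $c_{x\sigma},c^\dagger_{x\sigma}$ ($x\in\Lambda$, $\sigma\in\{\uparrow,\downarrow\}$) obeying the canonical anticommutation relations, vacuum $\Phi_0$, $n_{x\sigma}=c^\dagger_{x\sigma}c_{x\sigma}$, $\hat N_{\rm e}=\sum_x(n_{x\uparrow}+n_{x\downarrow})$. The Hubbard Hamiltonian is $H=H_{\rm hop}+H_{\rm int}$, $H_{\rm hop}=\sum_{x,y\in\Lambda}\sum_\sigma t_{xy}c^\dagger_{x\sigma}c_{y\sigma}$, $H_{\rm int}=\sum_xU_xn_{x\uparrow}n_{x\downarrow}$, with $(t_{xy})$ real symmetric and all $U_x>0$. Let $\varepsilon_0$ be the smallest eigenvalue of $(t_{xy})$, $\mathcal H_0$ its eigenspace, $N_{\rm d}=\dim\mathcal H_0$, and $\{\varphi^{(u)}\}_{u\in V}$ a basis of $\mathcal H_0$ indexed by a finite set $V$; $a^\dagger_{u\sigma}=\sum_x\varphi^{(u)}_xc^\dagger_{x\sigma}$.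 Conditions: B0: $\{\varphi^{(u)}\}_{u\in V}$ is a linearly independent complete basis of $\mathcal H_0$ (so $|V|=N_{\rm d}$) and each $\varphi^{(u)}$ is real-valued. B1 (quasi-locality): for each $u\in V$ there is a site $x(u)\in\Lambda$ with $\varphi^{(u)}_{x(u)}\ne0$ and $\varphi^{(v)}_{x(u)}=0$ for all $v\ne u$. B2 (local connectivity): for each $x\in\Lambda$ there are at most two indices $u\in V$ with $\varphi^{(u)}_x\ne0$. States $\Phi_{A,\{m_k\}}$: two indices $u,v\in V$ are directly connected if $\varphi^{(u)}_x\varphi^{(v)}_x\neq0$ for some $x$; for $A\subset V$ with connected components $C_1,\dots,C_n$ (w.r.t. direct connection), let $\Lambda_k=\{x:\varphi^{(u)}_x\ne0\text{ for some }u\in C_k\}$, $\hat S^-_k=\sum_{x\in\Lambda_k}c^\dagger_{x\downarrow}c_{x\uparrow}$, and for $m_k\in\{-|C_k|/2,1-|C_k|/2,\dots,|C_k|/2\}$ set $\Phi_{A,\{m_k\}}=\{\prod_{k=1}^n(\hat S^-_k)^{|C_k|/2-m_k}\}\prod_{u\in A}a^\dagger_{u\uparrow}\Phi_0$. *)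

(* Defs.v *)
From HB Require Import structures.
From mathcomp Require Import all_boot all_order all_algebra.
From mathcomp Require Import reals complex.
Set Implicit Arguments. Unset Strict Implicit. Unset Printing Implicit Defensive.
Import Order.TTheory GRing.Theory Num.Theory.
Local Open Scope ring_scope.

Section Hubbard.
Variables (R : realType) (L : finType).
Local Notation C := R[i].

(* single-particle modes (x, sigma); sigma = true is spin up, false is spin down *)
Definition mode : finType := (L * bool)%type.
(* Fock space: complex coefficient functions on occupation configurations;
   the basis vector of a set B of occupied modes is
   c^dag_{s_1} ... c^dag_{s_k} Phi_0 with s_1 < ... < s_k (enum_rank order). *)
Definition fock := {ffun {set mode} -> C}.

Definition toC (x : R) : C := Complex x 0.

Definition jw_sign (s : mode) (B : {set mode}) : C :=
  (-1) ^+ #|[set s' in B | (enum_rank s' < enum_rank s)%N]|.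

Definition cdag (s : mode) (v : fock) : fock :=
  [ffun B : {set mode} => if s \in B then jw_sign s (B :\ s) * v (B :\ s) else 0].
Definition cann (s : mode) (v : fock) : fock :=
  [ffun B : {set mode} => if s \in B then 0 else jw_sign s B * v (s |: B)].

Definition nop (s : mode) (v : fock) : fock := cdag s (cann s v).
Definition vacuum : fock := [ffun B : {set mode} => (B == set0)%:R].
Definition Nop (v : fock) : fock := \sum_(s : mode) nop s v.

Definition hubbardH (t : L -> L -> R) (U : L -> R) (v : fock) : fock :=
  \sum_(x : L) \sum_(y : L) \sum_(sg : bool) toC (t x y) *: cdag (x, sg) (cann (y, sg) v)
  + \sum_(x : L) toC (U x) *: nop (x, true) (nop (x, false) v).

Definition is_eigval_t (t : L -> L -> R) (e : R) : Prop :=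
  exists phi : L -> R, (exists x, phi x != 0) /\
    forall x, \sum_(y : L) t x y * phi y = e * phi x.
Definition is_min_eigval_t (t : L -> L -> R) (e : R) : Prop :=
  is_eigval_t t e /\ forall e', is_eigval_t t e' -> e <= e'.

Definition in_H0 (t : L -> L -> R) (e : R) (psi : L -> C) : Prop :=
  forall x, \sum_(y : L) toC (t x y) * psi y = toC e * psi x.

Section Basis.
Variable (V : finType).
Variable (phi : V -> L -> R).

Definition condB0 (t : L -> L -> R) (e : R) : Prop :=
  [/\ forall u, in_H0 t e (fun x => toC (phi u x)),
      forall a : V -> C, (forall x, \sum_(u : V) a u * toC (phi u x) = 0) ->
                         forall u, a u = 0 &
      forall psi : L -> C, in_H0 t e psi ->
        exists a : V -> C, forall x, psi x = \sum_(u : V) a u * toC (phi u x)].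

Definition condB1 : Prop :=
  forall u, exists x, phi u x != 0 /\ forall v, v != u -> phi v x = 0.

Definition condB2 : Prop :=
  forall x, leq #|[set u | phi u x != 0]| 2.

Definition adag (u : V) (sg : bool) (v : fock) : fock :=
  \sum_(x : L) toC (phi u x) *: cdag (x, sg) v.

Definition dconn (u v : V) : bool := [exists x, phi u x * phi v x != 0].
Definition conn_rel (A : {set V}) : rel V :=
  fun u v => [&& u \in A, v \in A & dconn u v].
Definition component (A : {set V}) (u : V) : {set V} :=
  [set v | connect (conn_rel A) u v].
Definition comps (A : {set V}) : {set {set V}} := [set component A u | u in A].
Definition sites (K : {set V}) : {set L} := [set x | [exists u in K, phi u x != 0]].
Definition Sminus (K : {set V}) (v : fock) : fock :=
  \sum_(x in sites K) cdag (x, false) (cann (x, true) v).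

(* Phi_{A,{m_k}}, parametrised by j_k = |C_k|/2 - m_k in {0,...,|C_k|} *)
Definition PhiA (A : {set V}) (j : {set V} -> nat) : fock :=
  let base := foldr (fun u w => adag u true w) vacuum (enum A) in
  foldr (fun K w => iter (j K) (Sminus K) w) base (enum (comps A)).

Definition jtype := {ffun {set V} -> 'I_(#|V|.+1)}.
Definition admissible (A : {set V}) (j : jtype) : bool :=
  [forall K in comps A, (j K <= #|K|)%N].

Definition in_span_Phi (Ne : nat) (v : fock) : Prop :=
  exists coef : {set V} -> jtype -> C,
    v = \sum_(A : {set V} | #|A| == Ne)
          \sum_(j : jtype | admissible A j) coef A j *: PhiA A (fun K => nat_of_ord (j K)).
End Basis.

Definition in_sector (Ne : nat) (v : fock) : Prop := Nop v = Ne%:R *: v.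

Definition gs_energy (H : fock -> fock) (Ne : nat) (E : R) : Prop :=
  (exists v, [/\ v != 0, in_sector Ne v & H v = toC E *: v]) /\
  forall (v : fock) (E' : C), v != 0 -> in_sector Ne v -> H v = E' *: v ->
    toC E <= E'.

Definition is_ground_state (H : fock -> fock) (Ne : nat) (v : fock) : Prop :=
  exists E, gs_energy H Ne E /\ [/\ v != 0, in_sector Ne v & H v = toC E *: v].

End Hubbard.

(* Main.v *)
(** Shifting H by eps0 N leaves, for a state v, a sum over configurations of the
    quadratic forms of t - eps0 evaluated at the orbitals x |-> (c_{x,sigma} v)(B),
    plus sum_x U_x |c_{x,dn} c_{x,up} v|^2.  So H >= eps0 N, with equality iff
    every such orbital lies in H_0 and v has no doubly occupied site.  The first
    condition puts v in the Fock space generated by the a^dag_u; there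
    b_u = c_{x(u)} / phi^(u)_{x(u)} is dual to a^dag_u and
    c_x = sum_u phi^(u)_x b_u.  By B1 the second condition at x = x(u) excludes
    double occupation of u; by B2, at a site shared by u and w it says that the
    coefficients of v are symmetric under exchange of the spins of u and w.
    Hence they depend only on the occupied set A and on the number of down spins
    in each component of A, which is what the states Phi_{A,m} span.  As no u is
    doubly occupied, such a v needs N_e <= |V|. *)

Require Import Defs.
From HB Require Import structures.
From mathcomp Require Import all_boot all_order all_algebra.
From mathcomp Require Import reals complex spectral zify.
Set Implicit Arguments. Unset Strict Implicit. Unset Printing Implicit Defensive.
Import Order.TTheory GRing.Theory Num.Theory.
Local Open Scope ring_scope.
Local Open Scope sesquilinear_scope.

(** * Real scalars, enumerations and shifted diagonalisations *)

Lemma conj_toC (R : realType) (a : R) : (toC a)^* = toC a.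
Proof. by apply: conj_Creal; rewrite complex_real. Qed.

Lemma toC_natM (R : realType) (n : nat) (a : R) : toC (n%:R * a) = n%:R * toC a.
Proof. by rewrite -(rmorph_nat (real_complex R)); exact: (rmorphM (real_complex R)). Qed.

Lemma toC_eq0 (R : realType) (a : R) : (toC a == 0 :> R[i]) = (a == 0).
Proof. by rewrite eq_complex /= eqxx andbT. Qed.

Lemma toC0 (R : realType) : toC 0 = 0 :> R[i].
Proof. by []. Qed.

Lemma index_enum_rank (T : finType) (x : T) : index x (enum T) = enum_rank x.
Proof.
by rewrite -{1}(nth_enum_rank x x) index_uniq ?enum_uniq // -cardE ltn_ord.
Qed.

Lemma filter_enum (T : finType) (A : {set T}) : enum A = [seq x <- enum T | x \in A].
Proof. by rewrite [enum T]enumT. Qed.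

Lemma diagonalized_shift (F : fieldType) n (P A : 'M[F]_n) (d : 'rV_n) (e : F) (z : 'cV_n) :
  P \in unitmx -> A = invmx P *m diag_mx d *m P ->
  A *m z - e *: z = invmx P *m diag_mx (\row_i (d 0 i - e)) *m (P *m z).
Proof.
move=> P_unit ->.
have -> : diag_mx (\row_i (d 0 i - e)) = diag_mx d - e%:M.
  by apply/matrixP => i j; rewrite !mxE; case: eqVneq => // _; rewrite ?mulr1n // !mulr0n subr0.
rewrite mulmxBr mulmxBl !mulmxA mul_mx_scalar -scalemxAl mulVmx //.
by rewrite -scalemxAl mul1mx.
Qed.

(** * The one-particle quadratic form *)

Section OneParticle.
Variables (R : realType) (L : finType) (t : L -> L -> R).

(** As [t] is real, the real and imaginary parts of [psi] solve the same equation, and one of them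
    is nonzero at [x0]. This links the complex spectral theorem to the real eigenvectors demanded by
    [is_eigval_t]. *)
Lemma is_eigval_complex (k : R) (psi : L -> R[i]) x0 :
  psi x0 != 0 -> in_H0 t k psi -> is_eigval_t t k.
Proof.
move=> psi0 Hpsi.
have ReE x : \sum_y t x y * complex.Re (psi y) = k * complex.Re (psi x).
  have /(congr1 (@complex.Re R)) := Hpsi x.
  rewrite [X in _ = X -> _](_ : _ = k * complex.Re (psi x)); last first.
    by case: (psi x) => a b /=; rewrite mul0r subr0.
  move=> <-; rewrite (raddf_sum (@complex.Re R : Rcomplex R -> R)).
  by apply: eq_bigr => y _; case: (psi y) => c d /=; rewrite mul0r subr0.
have ImE x : \sum_y t x y * complex.Im (psi y) = k * complex.Im (psi x).
  have /(congr1 (@complex.Im R)) := Hpsi x.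
  rewrite [X in _ = X -> _](_ : _ = k * complex.Im (psi x)); last first.
    by case: (psi x) => a b /=; rewrite mul0r addr0.
  move=> <-; rewrite (raddf_sum (@complex.Im R : Rcomplex R -> R)).
  by apply: eq_bigr => y _; case: (psi y) => c d /=; rewrite mul0r addr0.
have [Re0|Re0] := eqVneq (complex.Re (psi x0)) 0.
- exists (fun x => complex.Im (psi x)); split=> //; exists x0.
  move: psi0 Re0; case: (psi x0) => a b /=; rewrite eq_complex /= => ab0 a0.
  by move: ab0; rewrite a0 eqxx.
- by exists (fun x => complex.Re (psi x)); split=> //; exists x0.
Qed.

Hypothesis t_sym : forall x y, t x y = t y x.
Variable eps0 : R.
Hypothesis eps0_min : forall e, is_eigval_t t e -> eps0 <= e.

Definition excess (z : L -> R[i]) : R[i] :=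
  \sum_x (z x)^* * (\sum_y toC (t x y) * z y - toC eps0 * z x).

Let n := #|L|.
Let A : 'M[R[i]]_n := \matrix_(i, j) toC (t (enum_val i) (enum_val j)).
Let P := spectralmx A.
Let d := spectral_diag A.

Let A_herm : A \is hermsymmx.
Proof.
apply/is_hermitianmxP; rewrite expr0 scale1r.
by apply/matrixP => i j; rewrite !mxE t_sym conj_toC.
Qed.

Let A_spec : A = invmx P *m diag_mx d *m P.
Proof. exact/orthomx_spectralP/hermitian_normalmx. Qed.

Let P_unit : P \in unitmx.
Proof. exact: spectral_unit. Qed.

Lemma sum_enum (F : L -> R[i]) : \sum_x F x = \sum_(i < n) F (enum_val i).
Proof.
rewrite (reindex (@enum_val L L)); last by apply: onW_bij; exact: enum_val_bij.
by [].
Qed.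

Let d_ge i : toC eps0 <= d 0 i.
Proof.
have /mxOverP/(_ 0 i)/complex_realP[k dk] := hermitian_spectral_diag_real A_herm.
rewrite [d 0 i]dk lecR; apply: eps0_min.
(* Column [i] of [invmx P] is an eigenvector for [d 0 i]; it is nonzero because [P] times it is a
   unit vector. *)
pose psi x := invmx P (enum_rank x) i.
have [x0 psi0] : exists x, psi x != 0.
  apply/existsP; apply: contraT; rewrite negb_exists => /forallP psi0.
  have /matrixP/(_ i i) := mulmxV P_unit.
  rewrite !mxE eqxx big1 => [/eqP|j _]; first by rewrite eq_sym oner_eq0.
  by have /eqP := negbNE (psi0 (enum_val j)); rewrite /psi enum_valK => ->; rewrite mulr0.
apply: (is_eigval_complex (psi := psi) psi0) => x.
have : A *m invmx P = invmx P *m diag_mx d by rewrite A_spec mulmxK.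
move=> /matrixP/(_ (enum_rank x) i); rewrite mul_mx_diag !mxE sum_enum.
rewrite [spectral_diag A 0 i]dk mulrC => <-.
by apply: eq_bigr => j _; rewrite mxE /psi enum_rankK enum_valK.
Qed.

Let Z (z : L -> R[i]) : 'cV[R[i]]_n := \col_i z (enum_val i).

Let A_shift z : A *m Z z - toC eps0 *: Z z
  = invmx P *m diag_mx (\row_i (d 0 i - toC eps0)) *m (P *m Z z).
Proof.
exact: diagonalized_shift P_unit A_spec.
Qed.

(** Since [P] is unitary, the form becomes a weighted sum of squared moduli of the coordinates of
    [z] in an eigenbasis. By [d_ge] all weights are nonnegative. *)
Let excessE z :
  excess z = \sum_i (d 0 i - toC eps0) * `|(P *m Z z) i 0| ^+ 2.
Proof.
have -> : excess z = ((Z z)^t* *m (A *m Z z - toC eps0 *: Z z)) 0 0.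
  rewrite mxE /excess sum_enum; apply: eq_bigr => i _; rewrite !mxE.
  by rewrite sum_enum; congr (_ * (_ - _)); apply: eq_bigr => j _; rewrite !mxE.
have invP : invmx P = P^t*.
  exact: invmx_unitary (spectral_unitarymx A).
rewrite A_shift invP !mulmxA.
have -> : (Z z)^t* *m P^t* = (P *m Z z)^t* by rewrite trmx_mul map_mxM.
rewrite -mulmxA; move: (P *m Z z) => w; rewrite mul_mx_diag mxE; apply: eq_bigr => i _.
by rewrite !mxE normCKC mulrCA mulrA.
Qed.

Lemma excess_ge0 z : 0 <= excess z.
Proof.
rewrite excessE; apply: sumr_ge0 => i _.
by rewrite mulr_ge0 ?exprn_ge0 // subr_ge0.
Qed.

(** Every summand vanishes, so each eigencoordinate of [z] is zero unless its eigenvalue equals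
    [eps0]; hence [t - eps0] kills [z]. *)
Lemma excess_eq0 z : excess z = 0 -> in_H0 t eps0 z.
Proof.
rewrite excessE => /eqP; rewrite psumr_eq0 => [|i _]; last first.
  by rewrite mulr_ge0 ?exprn_ge0 // subr_ge0.
move=> /allP all0 x.
have : A *m Z z - toC eps0 *: Z z = 0.
  rewrite A_shift -mulmxA; set w := _ *m (P *m _); suff -> : w = 0 by rewrite mulmx0.
  apply/colP => i; rewrite /w mul_diag_mx [LHS]mxE [RHS]mxE [X in X * _]mxE.
  have /all0 := mem_index_enum i; rewrite /= mulf_eq0 expf_eq0 /= normr_eq0.
  by case/orP => /eqP ->; rewrite ?mul0r ?mulr0.
move=> /colP/(_ (enum_rank x)); rewrite !mxE enum_rankK => /eqP; rewrite subr_eq0 => /eqP <-.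
by rewrite sum_enum; apply: eq_bigr => j _; rewrite !mxE enum_rankK.
Qed.

End OneParticle.

(** * Canonical anticommutation relations *)

Section CanonicalRelations.
Variables (R : realType) (L : finType).
Implicit Types (s r : mode L) (B : {set mode L}) (v w : fock R L) (a : R[i]).

Local Notation before s r := (enum_rank s < enum_rank r)%N.
Local Notation jw s B := (@jw_sign R L s B).

Lemma jw_signU1 s r B : r \notin B -> jw s (r |: B) = (-1) ^+ before r s * jw s B.
Proof.
move=> rB; rewrite /jw_sign -exprD; congr (_ ^+ _).
case: (boolP (before r s)) => rs.
- rewrite (_ : [set s' in r |: B | before s' s] = r |: [set s' in B | before s' s]).
    by rewrite cardsU1 !inE (negbTE rB).
  by apply/setP => q; rewrite !inE; case: eqVneq => // ->; rewrite rs.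
- apply: eq_card => q; rewrite !inE.
  by case: eqVneq => // ->; rewrite (negbTE rB) (negbTE rs).
Qed.

Lemma jw_sign_sqr s B : jw s B * jw s B = 1.
Proof. by rewrite /jw_sign -expr2 sqrr_sign. Qed.

Lemma jw_sign_neq0 s B : jw s B != 0.
Proof. by rewrite /jw_sign signr_eq0. Qed.

Lemma conj_jw_sign s B : (jw s B)^* = jw s B.
Proof. by rewrite /jw_sign rmorph_sign. Qed.

Lemma before_swap s r : s != r -> (-1) ^+ before s r = - (-1) ^+ before r s :> R[i].
Proof.
move=> sr; have : enum_rank s != enum_rank r by rewrite (inj_eq enum_rank_inj).
rewrite -(inj_eq val_inj) /= => sr'.
by case: ltngtP sr' => // _ _; rewrite ?opprK.
Qed.

(** Exactly one of two distinct modes precedes the other, so exactly one of the two signs picks up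
    an extra factor -1. All anticommutation relations rest on this. *)
Lemma jw_sign_swap s r B : s != r -> s \notin B -> r \notin B ->
  jw s B * jw r (s |: B) = - (jw r B * jw s (r |: B)).
Proof.
move=> sr sB rB; rewrite !jw_signU1 // (before_swap sr) !mulNr mulrN.
by rewrite mulrCA [in RHS]mulrCA [jw r B * _]mulrC.
Qed.

Lemma cdag_is_linear s : linear (@cdag R L s).
Proof.
move=> a v w; apply/ffunP => B; rewrite !ffunE.
by case: ifP => _; rewrite ?scaler0 ?addr0 // mulrDr mulrCA.
Qed.
HB.instance Definition _ s :=
  GRing.isLinear.Build R[i] (fock R L) (fock R L) *:%R (cdag s) (cdag_is_linear s).

Lemma cann_is_linear s : linear (@cann R L s).
Proof.
move=> a v w; apply/ffunP => B; rewrite !ffunE.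
by case: ifP => _; rewrite ?scaler0 ?addr0 // mulrDr mulrCA.
Qed.
HB.instance Definition _ s :=
  GRing.isLinear.Build R[i] (fock R L) (fock R L) *:%R (cann s) (cann_is_linear s).

Lemma cann_anticomm s r v : cann s (cann r v) = - cann r (cann s v).
Proof.
apply/ffunP => B; rewrite !ffunE !inE.
have [->|sr] := eqVneq s r.
  by rewrite /= !mulr0 !if_same oppr0.
rewrite /=.
case: (boolP (s \in B)) => sB; case: (boolP (r \in B)) => rB /=; rewrite ?mulr0 ?oppr0 //.
by rewrite !mulrA (jw_sign_swap sr) // mulNr setUCA.
Qed.

Lemma cdag_anticomm s r v : cdag s (cdag r v) = - cdag r (cdag s v).
Proof.
apply/ffunP => B; rewrite !ffunE !inE.
have [->|sr] := eqVneq s r.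
  by rewrite /= !mulr0 !if_same oppr0.
rewrite /=.
case: (boolP (s \in B)) => sB; case: (boolP (r \in B)) => rB /=; rewrite ?mulr0 ?oppr0 //.
have -> : B :\ s :\ r = B :\ r :\ s by rewrite !setDDl setUC.
set B' := B :\ r :\ s.
have Es : B :\ s = r |: B'.
  by rewrite /B'; apply/setP => q; rewrite !inE; case: (eqVneq q r) => //= ->; rewrite rB eq_sym sr.
have Er : B :\ r = s |: B'.
  by rewrite /B'; apply/setP => q; rewrite !inE; case: (eqVneq q s) => //= ->; rewrite sB sr.
rewrite !mulrA Er Es [X in X * _]mulrC [jw r _ * _]mulrC (@jw_sign_swap r s) ?mulNr //.
- by rewrite eq_sym.
- by rewrite !inE eqxx andbF.
- by rewrite !inE eqxx.
Qed.

Lemma cann_cdag s r v : cann s (cdag r v) = (s == r)%:R *: v - cdag r (cann s v).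
Proof.
apply/ffunP => B; rewrite !ffunE !inE.
have [->|sr] := eqVneq s r.
  rewrite scale1r; case: (boolP (r \in B)) => rB /=.
    by rewrite mulrA jw_sign_sqr mul1r setD1K ?subrr.
  by rewrite setU1K // mulrA jw_sign_sqr mul1r subr0.
rewrite scale0r /= sub0r.
case: (boolP (s \in B)) => sB; case: (boolP (r \in B)) => rB /=;
  rewrite ?mulr0 ?oppr0 ?subr0 ?addr0 //.
(* Only the case of [r] occupied and [s] empty remains; all signs are compared over the common part
   [B']. *)
set B' := B :\ r.
have EB : B = r |: B' by rewrite setD1K.
have sB' : s \notin B' by rewrite !inE negb_and sB orbT.
have rB' : r \notin B' by rewrite !inE eqxx.
have -> : (s |: B) :\ r = s |: B' by rewrite {1}EB setUCA setU1K // in_setU1 negb_or eq_sym sr.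
rewrite !mulrA -mulNr {1}EB; congr (_ * _).
rewrite !jw_signU1 // (before_swap sr) mulrACA mulrN -expr2 sqrr_sign.
by rewrite mulN1r [jw s B' * _]mulrC.
Qed.

Lemma nopE s v B : nop s v B = (s \in B)%:R * v B.
Proof.
rewrite !ffunE; case: ifP => sB; last by rewrite mul0r.
by rewrite !inE eqxx /= mulrA jw_sign_sqr !mul1r setD1K.
Qed.

Lemma NopE v B : Nop v B = #|B|%:R * v B.
Proof.
rewrite /Nop sum_ffunE (eq_bigr (fun s => (s \in B)%:R * v B)) => [|s _]; last exact: nopE.
rewrite -mulr_suml -sum1_card natr_sum [in RHS]big_mkcond; congr (_ * _).
by apply: eq_bigr => s _; case: (s \in B).
Qed.

Lemma in_sectorP (n : nat) v :
  in_sector n v <-> forall B, v B != 0 -> #|B| = n.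
Proof.
split=> [/ffunP vn B vB | vn].
  by have /eqP := vn B; rewrite NopE !ffunE (inj_eq (mulIf vB)) eqr_nat => /eqP.
apply/ffunP => B; rewrite NopE !ffunE.
by have [->|/vn ->] := eqVneq (v B) 0; rewrite ?mulr0 ?scaler0.
Qed.

(** Inserting [s] is a bijection from the configurations without [s] onto those with [s], and the
    sign it carries is real. *)
Lemma cann_adjoint s v w :
  \sum_B (v B)^* * cdag s w B = \sum_B (cann s v B)^* * w B.
Proof.
rewrite (bigID (fun B => s \in B)) /= [X in _ + X]big1 ?addr0; last first.
  by move=> B /negbTE sB; rewrite ffunE sB mulr0.
rewrite [RHS](bigID (fun B => s \in B)) /= [X in _ = X + _]big1 ?add0r; last first.
  by move=> B sB; rewrite ffunE sB conjC0 mul0r.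
rewrite (reindex_onto (fun B => s |: B) (fun B => B :\ s)) /=; last first.
  by move=> B sB; rewrite setD1K.
apply: eq_big => [B|B].
  rewrite setU11 /=; apply/eqP/idP => [<-|sB]; first by rewrite !inE eqxx.
  exact: setU1K.
case/andP => _ /eqP BE; have sB : s \notin B by rewrite -BE !inE eqxx.
rewrite !ffunE setU11 (negbTE sB) BE rmorphM /= conj_jw_sign.
by rewrite mulrCA mulrA.
Qed.

Lemma cann_sector s n v : in_sector n.+1 v -> in_sector n (cann s v).
Proof.
move=> /in_sectorP vn; apply/in_sectorP => B; rewrite ffunE.
case: ifPn => sB; first by rewrite eqxx.
by rewrite mulf_eq0 negb_or => /andP[_ /vn]; rewrite cardsU1 sB => -[].
Qed.

Lemma cann_vacuum s : cann s (vacuum R L) = 0.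
Proof.
apply/ffunP => B; rewrite !ffunE; case: ifP => // _.
by rewrite setU_eq0 -cards_eq0 cards1 mulr0.
Qed.

End CanonicalRelations.

(** * The energy bound *)

Section Energy.
Variables (R : realType) (L : finType) (t : L -> L -> R) (U : L -> R) (eps0 : R).
Implicit Types (s : mode L) (B : {set mode L}) (v w : fock R L).

Definition dot v w : R[i] := \sum_B (v B)^* * w B.

Lemma dot_is_linear v : scalar (dot v).
Proof.
move=> a w1 w2; rewrite /dot mulr_sumr -big_split /=; apply: eq_bigr => B _.
by rewrite !ffunE mulrDr mulrCA.
Qed.
HB.instance Definition _ v :=
  GRing.isLinear.Build R[i] (fock R L) R[i] *%R (dot v) (dot_is_linear v).

Lemma dot_ge0 v : 0 <= dot v v.
Proof. by apply: sumr_ge0 => B _; rewrite -normCKC exprn_ge0. Qed.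

Lemma dot_gt0 v : v != 0 -> 0 < dot v v.
Proof.
move=> v0; rewrite lt_neqAle dot_ge0 andbT eq_sym; apply: contra v0.
rewrite /dot psumr_eq0 => [/allP v0|B _]; last by rewrite -normCKC exprn_ge0.
apply/eqP/ffunP => B; rewrite ffunE; apply/eqP.
by have := v0 B (mem_index_enum B); rewrite /= -normCKC expf_eq0 normr_eq0.
Qed.

(* [defect s v] vanishes for all [s] iff [v] is built from minimal-energy orbitals. *)
Definition defect s v : fock R L :=
  \sum_y toC (t s.1 y) *: cann (y, s.2) v - toC eps0 *: cann s v.

Lemma defectE x sg v B : defect (x, sg) v B =
  \sum_y toC (t x y) * cann (y, sg) v B - toC eps0 * cann (x, sg) v B.
Proof.
rewrite !ffunE sum_ffunE; congr (_ - _).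
by apply: eq_bigr => y _; rewrite !ffunE.
Qed.

Definition double_occ v : fock R L :=
  \sum_x toC (U x) *: nop (x, true) (nop (x, false) v).

(** Adding and subtracting [eps0] times the number operator turns each hopping term into [cdag s]
    applied to a defect, so that only nonnegative pieces remain beside [eps0 N]. *)
Lemma hubbardHE v : hubbardH t U v =
  toC eps0 *: Nop v + \sum_s cdag s (defect s v) + double_occ v.
Proof.
congr (_ + _); rewrite /Nop scaler_sumr -big_split /=.
rewrite (eq_bigr (fun s => \sum_y toC (t s.1 y) *: cdag s (cann (y, s.2) v))); last first.
  move=> s _; rewrite /defect linearB linear_sum linearZ /= /nop addrC subrK.
  by apply: eq_bigr => y _; rewrite linearZ.
rewrite (eq_bigr (fun x => \sum_(sg : bool) \sum_y toC (t x y) *: cdag (x, sg) (cann (y, sg) v))).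
  by rewrite pair_big; apply: eq_bigr => -[x sg].
by move=> x _; exact: exchange_big.
Qed.

(** Moving [cdag s] to the left factor by adjointness leaves, for each spin and each configuration
    [B], the one-particle form at the orbital with values [cann (x, sg) v B]. *)
Lemma dot_cdag_defect v :
  dot v (\sum_s cdag s (defect s v))
  = \sum_(sg : bool) \sum_B excess t eps0 (fun x => cann (x, sg) v B).
Proof.
rewrite linear_sum /= (eq_bigr (fun s => dot (cann s v) (defect s v))); last first.
  by move=> s _; exact: cann_adjoint.
rewrite (eq_bigr (fun s => dot (cann (s.1, s.2) v) (defect (s.1, s.2) v))); last by case.
rewrite -(pair_bigA _ (fun x sg => dot (cann (x, sg) v) (defect (x, sg) v))) /= exchange_big.
apply: eq_bigr => sg _; rewrite exchange_big; apply: eq_bigr => B _.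
apply: eq_bigr => x _; by rewrite defectE.
Qed.

Lemma dot_double_occ v :
  dot v (double_occ v)
  = \sum_x toC (U x) *
      \sum_(B : {set mode L}) (((x, true) \in B) && ((x, false) \in B))%:R * `|v B| ^+ 2.
Proof.
rewrite linear_sum; apply: eq_bigr => x _; rewrite linearZ /=; congr (_ * _).
apply: eq_bigr => B _; rewrite !nopE normCKC [in RHS]mulrCA; congr (_ * _).
by rewrite mulrA -natrM mulnb.
Qed.

Hypothesis t_sym : forall x y, t x y = t y x.
Hypothesis U_gt0 : forall x, 0 < U x.
Hypothesis eps0_min : forall e, is_eigval_t t e -> eps0 <= e.

Let double_ge0 v x B : 0 <= (((x, true) \in B) && ((x, false) \in B))%:R * `|v B| ^+ 2.
Proof. by rewrite mulr_ge0 ?exprn_ge0. Qed.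

Let toCU_gt0 x : 0 < toC (U x) :> R[i].
Proof. by rewrite ltcR. Qed.

Lemma dot_double_occ_ge0 v : 0 <= dot v (double_occ v).
Proof.
rewrite dot_double_occ; apply: sumr_ge0 => x _.
by apply: mulr_ge0; [exact: ltW|exact: sumr_ge0].
Qed.

Lemma dot_cdag_defect_ge0 v : 0 <= dot v (\sum_s cdag s (defect s v)).
Proof.
by rewrite dot_cdag_defect; apply: sumr_ge0 => sg _; apply: sumr_ge0 => B _; exact: excess_ge0.
Qed.

Lemma dot_double_occ_eq0 v : dot v (double_occ v) = 0 ->
  forall x B, (x, true) \in B -> (x, false) \in B -> v B = 0.
Proof.
rewrite dot_double_occ => /eqP; rewrite psumr_eq0 => [/allP all0 x B xB1 xB2|x _]; last first.
  by apply: mulr_ge0; [exact: ltW|exact: sumr_ge0].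
have := all0 x (mem_index_enum x); rewrite /= mulf_eq0 gt_eqF //= psumr_eq0 //.
move=> /allP/(_ B (mem_index_enum B)); rewrite /= xB1 xB2 mul1r expf_eq0 normr_eq0 /=.
by move/eqP.
Qed.

Lemma dot_cdag_defect_eq0 v : dot v (\sum_s cdag s (defect s v)) = 0 ->
  forall s, defect s v = 0.
Proof.
rewrite dot_cdag_defect => /eqP; rewrite psumr_eq0 => [/allP all0 [x sg]|sg _]; last first.
  by apply: sumr_ge0 => B _; exact: excess_ge0.
have := all0 sg (mem_index_enum sg); rewrite /= psumr_eq0 => [/allP {}all0|B _]; last first.
  exact: excess_ge0.
apply/ffunP => B; have /eqP := all0 B (mem_index_enum B).
move=> /(excess_eq0 t_sym eps0_min)/(_ x) Hx.
by rewrite defectE [RHS]ffunE; apply/eqP; rewrite subr_eq0; apply/eqP; exact: Hx.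
Qed.

(** Pairing the eigenvalue equation with [v] writes [E - n eps0], times the positive norm, as a sum
    of two nonnegative terms. The [?= iff] form keeps the equality case, which characterises the
    minimal states. *)
Lemma eigenvalue_bound n (v : fock R L) (E : R[i]) :
  v != 0 -> in_sector n v -> hubbardH t U v = E *: v ->
  toC (n%:R * eps0) <= E ?= iff
    ((dot v (\sum_s cdag s (defect s v)) == 0) && (dot v (double_occ v) == 0)).
Proof.
move=> v0 vn Hv; have vv := dot_gt0 v0.
have EE : (E - toC (n%:R * eps0)) * dot v v
    = dot v (\sum_s cdag s (defect s v)) + dot v (double_occ v).
  have := congr1 (dot v) Hv; rewrite hubbardHE vn !linearD !linearZ /= => /esym.
  rewrite mulrBl => ->; set a := toC eps0 * _.
  suff -> : toC (n%:R * eps0) * dot v v = a by rewrite addrAC [a + _]addrC addrK.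
  by rewrite toC_natM /a mulrCA mulrA.
split.
  rewrite -subr_ge0 -(pmulr_lge0 _ vv) EE.
  by rewrite addr_ge0 ?dot_double_occ_ge0 ?dot_cdag_defect_ge0.
rewrite eq_sym -subr_eq0 -(inj_eq (mulIf (lt0r_neq0 vv))) mul0r EE.
by rewrite paddr_eq0 ?dot_double_occ_ge0 ?dot_cdag_defect_ge0.
Qed.

End Energy.

(** * The Fock space over the lowest orbitals *)

Section FockInduction.
Variables (R : realType) (L : finType).
Implicit Types (s : mode L) (f g : fock R L).

Definition basis_vec (B : {set mode L}) : fock R L := [ffun B' => (B' == B)%:R].

Lemma fock_basis f : f = \sum_B f B *: basis_vec B.
Proof.
apply/ffunP => B; rewrite sum_ffunE (bigD1 B) //= big1 ?addr0 => [|B' BB'].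
  by rewrite !ffunE eqxx; exact: esym (mulr1 _).
by rewrite !ffunE eq_sym (negbTE BB') scaler0.
Qed.

Lemma cdag_basis_vec s (B : {set mode L}) : s \notin B ->
  cdag s (basis_vec B) = jw_sign R s B *: basis_vec (s |: B).
Proof.
move=> sB; apply/ffunP => B'; rewrite !ffunE.
case: ifPn => sB'; last first.
  by case: eqP sB' => [->|]; rewrite ?setU11 // scaler0.
have [->|B'B] := eqVneq B' (s |: B); first by rewrite setU1K // eqxx.
have [E|] := eqVneq (B' :\ s) B; last by rewrite mulr0 scaler0.
by move: B'B; rewrite -E setD1K ?eqxx.
Qed.

(** Each basis vector is, up to sign, a product of creation operators on the vacuum, so operator
    identities need checking only on the vacuum and through [cdag]. *)
Lemma fock_cdag_ind (P : fock R L -> Prop) :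
  P (vacuum R L) -> (forall s f, P f -> P (cdag s f)) ->
  (forall a f g, P f -> P g -> P (a *: f + g)) -> forall f, P f.
Proof.
move=> P0 Pcdag Plin.
have Pz : P 0 by rewrite -(subrr (vacuum R L)) addrC -scaleN1r; exact: Plin.
have Pscale a f : P f -> P (a *: f) by move=> Pf; rewrite -[_ *: _]addr0; exact: Plin.
have Pbasis n (B : {set mode L}) : #|B| = n -> P (basis_vec B).
  elim: n B => [|n IH] B Bn.
    by rewrite (cards0_eq Bn).
  have /set0Pn[s sB] : B != set0 by rewrite -card_gt0 Bn.
  have sB' : s \notin B :\ s by rewrite !inE eqxx.
  rewrite -(setD1K sB) -[basis_vec _]scale1r -(jw_sign_sqr R s (B :\ s)) -scalerA.
  rewrite -cdag_basis_vec //; apply/Pscale/Pcdag/IH.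
  by apply/eqP; rewrite -eqSS -Bn (cardsD1 s B) sB.
move=> f; rewrite (fock_basis f); apply: big_ind => // [g h Pg Ph|B _].
  by rewrite -[g]scale1r; exact: Plin.
by apply: Pscale; exact: Pbasis (erefl _).
Qed.

End FockInduction.

(** * Flat states and the operators dual to [adag] *)

Section LowestBand.
Variables (R : realType) (L V : finType) (t : L -> L -> R) (eps0 : R).
Variables (phi : V -> L -> R) (site : V -> L).
Implicit Types (q : mode L) (s r : mode V) (v w : fock R L) (f : fock R V).

Hypothesis phi_eig : forall u, in_H0 t eps0 (fun x => toC (phi u x)).
Hypothesis phi_complete : forall psi : L -> R[i], in_H0 t eps0 psi ->
  exists a : V -> R[i], forall x, psi x = \sum_(u : V) a u * toC (phi u x).
Hypothesis site_neq0 : forall u, phi u (site u) != 0.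
Hypothesis site_eq0 : forall u u', u' != u -> phi u' (site u) = 0.

Definition flat v := forall q, defect t eps0 q v = 0.

Lemma flatP v : flat v <->
  forall x sg, \sum_y toC (t x y) *: cann (y, sg) v = toC eps0 *: cann (x, sg) v.
Proof.
split=> [vF x sg|vF [x sg]].
  by have /eqP := vF (x, sg); rewrite subr_eq0 => /eqP.
by rewrite /defect vF subrr.
Qed.

Lemma adag_is_linear u sg : linear (@adag R L V phi u sg).
Proof.
move=> a v w; rewrite /adag scaler_sumr -big_split; apply: eq_bigr => x _ /=.
by rewrite linearP scalerDr !scalerA mulrC.
Qed.
HB.instance Definition _ u sg :=
  GRing.isLinear.Build R[i] (fock R L) (fock R L) *:%R (adag phi u sg) (adag_is_linear u sg).

Lemma adagE u sg v : adag phi u sg v = \sum_x toC (phi u x) *: cdag (x, sg) v.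
Proof. by []. Qed.

(* By [site_eq0] only the orbital [u] is seen at [site u], so this is dual to [adag]. *)
Definition annih s v := (toC (phi s.1 (site s.1)))^-1 *: cann (site s.1, s.2) v.

Lemma annih_is_linear s : linear (annih s).
Proof. by move=> a v w; rewrite /annih linearP scalerDr !scalerA mulrC. Qed.
HB.instance Definition _ s :=
  GRing.isLinear.Build R[i] (fock R L) (fock R L) *:%R (annih s) (annih_is_linear s).

Lemma cdag_adag q u sg v : cdag q (adag phi u sg v) = - adag phi u sg (cdag q v).
Proof.
rewrite /adag linear_sum -sumrN; apply: eq_bigr => x _.
by rewrite linearZ /= cdag_anticomm scalerN.
Qed.

Lemma adag_anticomm u1 sg1 u2 sg2 v :
  adag phi u1 sg1 (adag phi u2 sg2 v) = - adag phi u2 sg2 (adag phi u1 sg1 v).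
Proof.
have -> : adag phi u2 sg2 (adag phi u1 sg1 v)
    = \sum_x toC (phi u1 x) *: adag phi u2 sg2 (cdag (x, sg1) v).
  by rewrite [adag phi u1 sg1 v]adagE linear_sum; apply: eq_bigr => x _; rewrite linearZ.
rewrite [LHS]adagE -sumrN; apply: eq_bigr => x _.
by rewrite cdag_adag scalerN.
Qed.

Lemma cann_adag x sg u sg' v : cann (x, sg) (adag phi u sg' v)
  = (toC (phi u x) * (sg == sg')%:R) *: v - adag phi u sg' (cann (x, sg) v).
Proof.
rewrite /adag linear_sum /= (eq_bigr (fun y => (toC (phi u y) * ((x, sg) == (y, sg'))%:R) *: v
    - toC (phi u y) *: cdag (y, sg') (cann (x, sg) v))); last first.
  by move=> y _; rewrite linearZ /= cann_cdag scalerBr scalerA.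
rewrite sumrB (bigD1 x) //= xpair_eqE eqxx big1 ?addr0 // => y /negbTE yx.
by rewrite xpair_eqE eq_sym yx mulr0 scale0r.
Qed.

(** For equal indices the normalisation of [annih] gives 1; for different ones [site_eq0] gives 0.
    Thus [annih] and [adag] obey canonical relations although the [phi u] need not be orthogonal. *)
Lemma annih_adag s r v : annih s (adag phi r.1 r.2 v)
  = (s == r)%:R *: v - adag phi r.1 r.2 (annih s v).
Proof.
case: s r => [u sg] [u' sg']; rewrite /annih /= cann_adag scalerBr [in RHS]linearZ scalerA.
suff -> : (toC (phi u (site u)))^-1 * (toC (phi u' (site u)) * (sg == sg')%:R)
    = ((u, sg) == (u', sg'))%:R by [].
rewrite xpair_eqE; have [<-|uu'] := eqVneq u u'; first by rewrite mulrA mulVf ?mul1r // toC_eq0.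
by rewrite (@site_eq0 u u') 1?eq_sym // toC0 mul0r mulr0.
Qed.

Lemma flat_cann q v : flat v -> flat (cann q v).
Proof.
move=> /flatP vF; apply/flatP => x sg; rewrite cann_anticomm scalerN -linearZ -vF linear_sum /=.
by rewrite -sumrN; apply: eq_bigr => y _; rewrite cann_anticomm scalerN [in RHS]linearZ.
Qed.

Lemma flatZ (a : R[i]) v : flat v -> flat (a *: v).
Proof.
move=> /flatP vF; apply/flatP => x sg; rewrite [cann _ (a *: v)]linearZ /=.
rewrite scalerA mulrC -scalerA -vF scaler_sumr; apply: eq_bigr => y _.
by rewrite [cann _ (a *: v)]linearZ !scalerA mulrC.
Qed.

Lemma flat_annih s v : flat v -> flat (annih s v).
Proof. by move=> vF; apply/flatZ/flat_cann. Qed.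

(** Commuting an annihilator past [adag] produces the amplitude [phi u x], which itself solves the
    eigenvalue equation for [eps0]. *)
Lemma flat_adag u sg v : flat v -> flat (adag phi u sg v).
Proof.
move=> /flatP vF; apply/flatP => x sg'; rewrite cann_adag scalerBr.
have -> : toC eps0 *: adag phi u sg (cann (x, sg') v)
    = \sum_y toC (t x y) *: adag phi u sg (cann (y, sg') v).
  transitivity (adag phi u sg (toC eps0 *: cann (x, sg') v)); first by rewrite [RHS]linearZ.
  by rewrite -vF linear_sum; apply: eq_bigr => y _; rewrite [LHS]linearZ.
rewrite scalerA mulrA -phi_eig mulr_suml scaler_suml -sumrB; apply: eq_bigr => y _.
by rewrite cann_adag scalerBr scalerA mulrA.
Qed.

Lemma flat_vacuum : flat (vacuum R L).
Proof.
by apply/flatP => x sg; rewrite cann_vacuum scaler0 big1 // => y _; rewrite cann_vacuum scaler0.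
Qed.

Lemma flat_cannE v x sg : flat v ->
  cann (x, sg) v = \sum_u toC (phi u x) *: annih (u, sg) v.
Proof.
move=> /flatP vF; apply/ffunP => B; rewrite sum_ffunE.
have /phi_complete[a Ha] : in_H0 t eps0 (fun x => cann (x, sg) v B).
  move=> y; transitivity ((toC eps0 *: cann (y, sg) v) B); last by rewrite [LHS]ffunE.
  by rewrite -vF sum_ffunE; apply: eq_bigr => z _; rewrite [RHS]ffunE.
(* Evaluated at [site u], the expansion of the orbital retains only its [u] term, so its
   coefficients are the values of [annih]. *)
have aE u : annih (u, sg) v B = a u.
  rewrite /annih [LHS]ffunE /= Ha (bigD1 u) //= big1 => [|w wu].
    by rewrite addr0 [_ *: _]mulrC mulfK // toC_eq0.
  by rewrite site_eq0 // toC0 mulr0.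
by rewrite Ha; apply: eq_bigr => u _; rewrite [RHS]ffunE aE [RHS]mulrC.
Qed.

Lemma flat_Nop v : flat v -> Nop v = \sum_(s : mode V) adag phi s.1 s.2 (annih s v).
Proof.
move=> vF; rewrite /Nop.
rewrite (eq_bigr (fun q => nop (q.1, q.2) v)) => [|[] //].
rewrite (eq_bigr (fun s => adag phi s.1 s.2 (annih (s.1, s.2) v))) => [|[] //].
rewrite -(pair_bigA _ (fun x sg => nop (x, sg) v)).
rewrite -(pair_bigA _ (fun u sg => adag phi u sg (annih (u, sg) v))) /=.
rewrite exchange_big [RHS]exchange_big; apply: eq_bigr => sg _ /=.
rewrite /adag [RHS]exchange_big; apply: eq_bigr => x _ /=.
rewrite /nop (flat_cannE _ _ vF) linear_sum; apply: eq_bigr => u _.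
by rewrite linearZ.
Qed.

(** * The embedding of the Fock space over [V] *)

Definition word (l : seq (mode V)) : fock R L :=
  foldr (fun s w => adag phi s.1 s.2 w) (vacuum R L) l.

Lemma word_insert s l1 l2 :
  adag phi s.1 s.2 (word (l1 ++ l2)) = (-1) ^+ size l1 *: word (l1 ++ s :: l2).
Proof.
elim: l1 => [|r l1 IH] /=; first by rewrite scale1r.
by rewrite adag_anticomm IH [adag _ _ _ (_ *: _)]linearZ -scaleN1r scalerA exprS.
Qed.

(** The position at which [s] enters the ordered list is the exponent in [jw_sign], so the sign of
    [word_insert] is the Jordan-Wigner sign over the modes of [V]. *)
Lemma enum_splitU1 s (B : {set mode V}) : s \notin B ->
  exists l1 l2, [/\ enum B = l1 ++ l2, enum (s |: B) = l1 ++ s :: l2 &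
    size l1 = #|[set r in B | (enum_rank r < enum_rank s)%N]|].
Proof.
move=> sB; set E := enum (mode V).
pose l1 := take (enum_rank s) E; pose l2 := drop (enum_rank s).+1 E.
have EE : E = l1 ++ s :: l2.
  rewrite -[s in s :: _](nth_enum_rank s) -drop_nth ?cat_take_drop //.
  by rewrite -cardE ltn_ord.
have sU : uniq (l1 ++ s :: l2) by rewrite -EE enum_uniq.
move: (sU); rewrite cat_uniq /= negb_or => /and4P[_ /andP[sl1 _] sl2 _].
exists [seq r <- l1 | r \in B], [seq r <- l2 | r \in B]; split.
- by rewrite filter_enum -/E EE filter_cat /= (negbTE sB).
- rewrite filter_enum -/E EE filter_cat /= setU11; congr (_ ++ _ :: _).
    by apply: eq_in_filter => r rl; rewrite in_setU1; case: eqVneq rl sl1 => // -> ->.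
  by apply: eq_in_filter => r rl; rewrite in_setU1; case: eqVneq rl sl2 => // -> ->.
- rewrite cardE filter_enum -/E {1}EE filter_cat size_cat [X in (_ + X)%N](_ : _ = 0%N) ?addn0.
    congr size; apply: eq_in_filter => r rl; rewrite inE.
    by rewrite -!index_enum_rank -in_take ?mem_enum // index_enum_rank rl andbT.
  apply/eqP; rewrite size_eq0 -[_ == _]negbK -has_filter; apply/hasPn => r rl.
  rewrite inE -!index_enum_rank -in_take ?mem_enum // index_enum_rank negb_and.
  apply/orP; right; move: sU; rewrite cat_uniq => /and3P[_ /hasPn H _].
  exact: H.
Qed.

Lemma adag_word s (B : {set mode V}) : s \notin B ->
  adag phi s.1 s.2 (word (enum B)) = jw_sign R s B *: word (enum (s |: B)).
Proof.
move=> /enum_splitU1[l1 [l2 [-> -> sl1]]].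
by rewrite word_insert sl1.
Qed.

Lemma adag_adag u sg v : adag phi u sg (adag phi u sg v) = 0.
Proof.
have := adag_anticomm u sg u sg v; set w := adag _ _ _ (adag _ _ _ _) => /eqP.
by rewrite -addr_eq0 -mulr2n -scaler_nat scaler_eq0 pnatr_eq0 => /eqP.
Qed.

Lemma adag_word_mem s (B : {set mode V}) : s \in B -> adag phi s.1 s.2 (word (enum B)) = 0.
Proof.
move=> sB; have sB' : s \notin B :\ s by rewrite !inE eqxx.
have := adag_word sB'; rewrite setD1K // => E.
have /eqP : jw_sign R s (B :\ s) *: adag phi s.1 s.2 (word (enum B)) = 0.
  transitivity (adag phi s.1 s.2 (jw_sign R s (B :\ s) *: word (enum B))).
    by rewrite [RHS]linearZ.
  by rewrite -E adag_adag.
by rewrite scaler_eq0 (negbTE (jw_sign_neq0 _ _ _)) => /eqP.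
Qed.

(** Represents the abstract fermions of [V] on the lattice: it will intertwine [cdag] with [adag]
    and [cann] with [annih]. *)
Definition embed f : fock R L := \sum_(B : {set mode V}) f B *: word (enum B).

Lemma embed_is_linear : linear embed.
Proof.
move=> a f g; rewrite /embed scaler_sumr -big_split; apply: eq_bigr => B _ /=.
by rewrite !ffunE scalerDl scalerA.
Qed.
HB.instance Definition _ :=
  GRing.isLinear.Build R[i] (fock R V) (fock R L) *:%R embed embed_is_linear.

Lemma embed_cdag s f : embed (cdag s f) = adag phi s.1 s.2 (embed f).
Proof.
rewrite [in RHS]/embed linear_sum /= {1}/embed [LHS](bigID (fun B : {set mode V} => s \in B)) /=.
rewrite [X in _ + X]big1 ?addr0 => [|B /negbTE sB]; last by rewrite ffunE sB scale0r.
rewrite [RHS](bigID (fun B : {set mode V} => s \in B)) /=.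
rewrite [X in _ = X + _]big1 ?add0r => [|B sB]; last first.
  by rewrite linearZ /= adag_word_mem ?scaler0.
rewrite (reindex_onto (fun B => s |: B) (fun B => B :\ s)) /= => [|B sB]; last by rewrite setD1K.
apply: eq_big => [B|B].
  rewrite setU11 /=; apply/eqP/idP => [<-|sB]; first by rewrite !inE eqxx.
  exact: setU1K.
case/andP => _ /eqP BE; have sB : s \notin B by rewrite -BE !inE eqxx.
by rewrite ffunE setU11 BE [RHS]linearZ /= adag_word // scalerA mulrC.
Qed.

Lemma embed_vacuum : embed (vacuum R V) = vacuum R L.
Proof.
rewrite /embed (bigD1 set0) //= big1 ?addr0 => [|B /negbTE B0]; last first.
  by rewrite ffunE B0 scale0r.
by rewrite ffunE eqxx scale1r enum_set0.
Qed.

Lemma annih_vacuum s : annih s (vacuum R L) = 0.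
Proof. by rewrite /annih cann_vacuum scaler0. Qed.

(** Both sides vanish on the vacuum and satisfy the same exchange relation with creation
    operators. *)
Lemma embed_cann s f : embed (cann s f) = annih s (embed f).
Proof.
elim/fock_cdag_ind: f => [|r f IH|a f g IHf IHg].
- by rewrite embed_vacuum annih_vacuum cann_vacuum linear0.
- by rewrite cann_cdag embed_cdag annih_adag -IH -embed_cdag linearB linearZ.
- by rewrite [cann s _]linearP [LHS]linearP /= IHf IHg [embed (_ + _)]linearP [RHS]linearP.
Qed.

Lemma adag_set0 u sg v : adag phi u sg v set0 = 0.
Proof.
rewrite sum_ffunE big1 // => x _; rewrite ffunE [X in _ *: X]ffunE inE.
by rewrite scaler0.
Qed.

Lemma embed_set0 f : embed f set0 = f set0.
Proof.
rewrite sum_ffunE (bigD1 set0) //= big1 ?addr0 => [|B B0].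
  by rewrite enum_set0 [LHS]ffunE /= ffunE eqxx; exact: mulr1.
rewrite [LHS]ffunE; suff -> : word (enum B) set0 = 0 by rewrite scaler0.
have : enum B != [::] by rewrite -size_eq0 -cardE cards_eq0.
by case: (enum B) => //= s l _; exact: adag_set0.
Qed.

(** Up to sign, the coefficient of [f] at [B] is obtained by annihilating the modes of [B] one by
    one and evaluating at [set0], where [embed] preserves values. *)
Lemma embed_eq0 f : embed f = 0 -> f = 0.
Proof.
move=> f0; apply/ffunP => B; rewrite [RHS]ffunE.
move: {2}#|B| (erefl #|B|) => n; elim: n B f f0 => [|n IH] B f f0 Bn.
  by rewrite (cards0_eq Bn) -embed_set0 f0 ffunE.
have /set0Pn[s sB] : B != set0 by rewrite -card_gt0 Bn.
have /(IH (B :\ s)) : embed (cann s f) = 0 by rewrite embed_cann f0 linear0.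
rewrite ffunE !inE eqxx /= setD1K // => H.
apply/eqP; rewrite -(mulrI_eq0 _ (lregP (jw_sign_neq0 R s (B :\ s)))) H //.
by apply/eqP; rewrite -eqSS -Bn (cardsD1 s B) sB.
Qed.

Lemma annih_sector s n v : in_sector n.+1 v -> in_sector n (annih s v).
Proof.
move=> /(cann_sector (site s.1, s.2))/in_sectorP H; apply/in_sectorP => B Bs.
by apply: H; apply: contraNneq Bs => E; rewrite [X in X == _]ffunE E scaler0.
Qed.

Lemma embed_surj n v : flat v -> in_sector n v -> exists f, v = embed f.
Proof.
elim: n v => [|n IH] v vF vn.
  exists (v set0 *: vacuum R V); rewrite linearZ /= embed_vacuum.
  apply/ffunP => B; rewrite !ffunE; case: eqP => [->|B0]; first by exact: esym (mulr1 _).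
  rewrite scaler0; apply/eqP; apply: contraT => vB.
  by case: B0; apply: cards0_eq; move/in_sectorP: vn; apply.
have /fin_all_exists[g gE] s : exists f, annih s v = embed f.
  by apply: IH; [exact: flat_annih | exact: annih_sector].
(* On a flat state the number operator is the sum of [adag] after [annih] over all modes of [V]; on
   this sector it is multiplication by [n.+1], so dividing recovers [v]. *)
exists (n.+1%:R^-1 *: \sum_s cdag s (g s)); rewrite linearZ linear_sum /=.
rewrite (eq_bigr (fun s => adag phi s.1 s.2 (annih s v))) => [|s _]; last first.
  by rewrite embed_cdag gE.
by rewrite -flat_Nop // vn scalerA mulVf ?scale1r // pnatr_eq0.
Qed.

Lemma embed_inj f g : embed f = embed g -> f = g.
Proof.
by move=> E; apply/eqP; rewrite -subr_eq0; apply/eqP/embed_eq0; rewrite linearB /= E subrr.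
Qed.

Lemma Nop_embed f : flat (embed f) -> Nop (embed f) = embed (Nop f).
Proof.
move=> fF; rewrite flat_Nop // [RHS]linear_sum.
by apply: eq_bigr => s _; rewrite /= /nop embed_cdag embed_cann.
Qed.

Lemma embed_sector n f : flat (embed f) -> in_sector n (embed f) -> in_sector n f.
Proof.
by move=> fF fn; apply: embed_inj; rewrite -Nop_embed // fn [RHS]linearZ.
Qed.

(** Absence of double occupancy at [x] says that annihilating both spins there gives zero. Expanding
    both annihilators by [flat_cannE] and using injectivity of [embed] pulls this back to a relation
    on [f]. *)
Lemma embed_pair x f : flat (embed f) ->
  (forall B : {set mode L}, (x, true) \in B -> (x, false) \in B -> embed f B = 0) ->
  \sum_u \sum_u' (toC (phi u x) * toC (phi u' x)) *: cann (u', false) (cann (u, true) f) = 0.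
Proof.
move=> fF f0; apply: embed_eq0.
have : cann (x, false) (cann (x, true) (embed f)) = 0.
  apply/ffunP => B; rewrite !ffunE; case: ifP => // _; case: ifP => _; rewrite ?mulr0 //.
  by rewrite f0 ?mulr0 // !inE eqxx ?orbT.
rewrite (flat_cannE _ _ fF) linear_sum => /= H; rewrite -[RHS]H linear_sum.
apply: eq_bigr => u _; rewrite [RHS]linearZ /= flat_cannE; last exact: flat_annih.
rewrite linear_sum scaler_sumr; apply: eq_bigr => w _.
by rewrite [LHS]linearZ /= !embed_cann [RHS]scalerA.
Qed.

End LowestBand.

(** * Spin configurations and the exchange symmetry *)

Section ModeOrder.
Variables (V : finType).
Implicit Types (u w : V).

Lemma enum_mode : enum (mode V) = flatten [seq [:: (u, true); (u, false)] | u <- enum V].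
Proof.
rewrite enumT unlock /= /prod_enum /allpairs_dep; congr flatten; apply: eq_map => u.
by rewrite enumT unlock.
Qed.

(** The two spins of an index are adjacent in the enumeration, up before down, whence the offset
    [~~ b]. *)
Lemma enum_rank_mode u b : enum_rank ((u, b) : mode V) = ((enum_rank u).*2 + ~~ b)%N :> nat.
Proof.
rewrite -!index_enum_rank enum_mode; have : u \in enum V by rewrite mem_enum.
elim: (enum V) => //= w l IH; rewrite inE eq_sym => uwl.
case: (eqVneq w u) uwl => [->|wu] /= ul; first by rewrite !xpair_eqE eqxx; case: (b).
by rewrite !xpair_eqE (negbTE wu) /= IH // doubleS.
Qed.

Lemma mode_before u b w b' : u != w ->
  (enum_rank ((u, b) : mode V) < enum_rank ((w, b') : mode V))%N
  = (enum_rank u < enum_rank w)%N.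
Proof.
move=> uw; have {uw} : (enum_rank u : nat) != enum_rank w.
  by rewrite (inj_eq val_inj) (inj_eq enum_rank_inj).
by rewrite !enum_rank_mode; case: b b' => [] []; lia.
Qed.

(* [S] is the set of indices carrying spin down. *)
Definition conf (A S : {set V}) : {set mode V} :=
  [set s : mode V | (s.1 \in A) && (s.2 == (s.1 \notin S))].

Lemma enum_conf (A S : {set V}) : enum (conf A S) = [seq (u, u \notin S) | u <- enum A].
Proof.
rewrite filter_enum enum_mode filter_flatten -map_comp filter_enum.
elim: (enum V) => //= u l ->; rewrite !inE /=.
by case: (u \in A) => //=; case: (u \in S).
Qed.

Lemma card_conf (A S : {set V}) : #|conf A S| = #|A|.
Proof. by rewrite !cardE enum_conf size_map. Qed.

Lemma conf_setU1 (A S : {set V}) u (b : bool) : u \notin A ->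
  conf (u |: A) (if b then S :\ u else u |: S) = (u, b) |: conf A S.
Proof.
move=> uA; apply/setP => -[w c]; rewrite !inE xpair_eqE /=.
have [->|wu] := eqVneq w u.
  by rewrite (negbTE uA) /= orbF; case: b; rewrite !inE eqxx; case: c.
by case: b; rewrite !inE (negbTE wu).
Qed.

End ModeOrder.

(** * Exchange symmetry forced by the absence of double occupancy *)

Section SpinSymmetry.
Variables (R : realType) (L V : finType) (phi : V -> L -> R) (site : V -> L).
Variable f : fock R V.
Implicit Types (u w : V) (A S : {set V}).

Hypothesis site_neq0 : forall u, phi u (site u) != 0.
Hypothesis site_eq0 : forall u u', u' != u -> phi u' (site u) = 0.
Hypothesis phi_le2 : condB2 phi.
Hypothesis f_pair : forall x,
  \sum_u \sum_u' (toC (phi u x) * toC (phi u' x)) *: cann (u', false) (cann (u, true) f) = 0.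

(** At [x = site u] all terms of [f_pair] vanish except the one with both indices equal to [u]. *)
Lemma no_double u : cann (u, false) (cann (u, true) f) = 0.
Proof.
have := f_pair (site u); rewrite (bigD1 u) //= [X in _ + X]big1 => [|w wu]; last first.
  by apply: big1 => w' _; rewrite (site_eq0 wu) toC0 mul0r scale0r.
rewrite (bigD1 u) //= big1 ?addr0 => [/eqP|w wu]; last first.
  by rewrite (site_eq0 wu) toC0 mulr0 scale0r.
by rewrite scaler_eq0 mulf_eq0 toC_eq0 (negbTE (site_neq0 u)) => /eqP.
Qed.

Lemma double_eq0 u (B : {set mode V}) : (u, true) \in B -> (u, false) \in B -> f B = 0.
Proof.
move=> uB1 uB2; set B0 := B :\ (u, true) :\ (u, false).
have EB : (u, true) |: ((u, false) |: B0) = B.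
  by rewrite /B0 setD1K ?setD1K // !inE xpair_eqE uB2 andbF.
have uB0 b : (u, b) \notin B0 by rewrite !inE !xpair_eqE eqxx; case: b.
have /ffunP/(_ B0) := no_double u.
rewrite !ffunE (negbTE (uB0 _)) in_setU1 (negbTE (uB0 _)) xpair_eqE andbF /= EB => /eqP.
by rewrite !mulf_eq0 !(negbTE (jw_sign_neq0 _ _ _)) => /eqP.
Qed.

(** At a site shared by [u] and [w], B2 leaves only these two indices. The diagonal terms vanish by
    [no_double], and the two mixed terms carry the same nonzero coefficient. *)
Lemma dconn_pair u w : u != w -> dconn phi u w ->
  cann (u, false) (cann (w, true) f) = - cann (w, false) (cann (u, true) f).
Proof.
move=> uw /existsP[x]; rewrite mulf_eq0 negb_or => /andP[ux wx].
have others u' : u' != u -> u' != w -> phi u' x = 0.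
  move=> u'u u'w; apply/eqP; apply: contraT => u'x.
  have := phi_le2 x; rewrite (cardsD1 u) (cardsD1 w) (cardsD1 u') !inE ux wx u'x.
  by rewrite u'u u'w eq_sym uw.
have two (F : V -> fock R V) : (forall u', u' != u -> u' != w -> F u' = 0) ->
    \sum_u' F u' = F u + F w.
  move=> F0; rewrite (bigD1 u) //= (bigD1 w) 1?eq_sym //= big1 ?addr0 // => u' /andP[u'u u'w].
  exact: F0.
have := f_pair x; rewrite two => [|u' u'u u'w]; last first.
  by apply: big1 => w' _; rewrite (others u') // toC0 mul0r scale0r.
rewrite !two => [|u' u'u u'w|u' u'u u'w]; try by rewrite (others u') // toC0 mulr0 scale0r.
rewrite !no_double !scaler0 add0r addr0 [toC (phi w x) * _]mulrC -scalerDr => /eqP.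
by rewrite scaler_eq0 mulf_eq0 !toC_eq0 (negbTE ux) (negbTE wx) /= addrC addr_eq0 => /eqP.
Qed.

Lemma jw_sign_mode u (B : {set mode V}) :
  (forall b, (u, b) \notin B) -> jw_sign R (u, false) B = jw_sign R (u, true) B.
Proof.
move=> uB; rewrite /jw_sign; congr (_ ^+ _); apply: eq_card => -[w b]; rewrite !inE.
have [E|wu] := eqVneq w u; first by rewrite E (negbTE (uB b)).
by rewrite !mode_before.
Qed.

(** Evaluating the operator relation at [conf A S] compares the two spin assignments. Its minus sign
    is cancelled by the fermionic sign of interchanging [u] and [w], which by [mode_before] does not
    depend on the spins. *)
Lemma exchange_conf A S u w : u \notin A -> w \notin A -> u != w -> u \notin S -> w \notin S ->
  dconn phi u w ->
  f (conf (u |: (w |: A)) (u |: S)) = f (conf (u |: (w |: A)) (w |: S)).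
Proof.
move=> uA wA uw uS wS /(dconn_pair uw)/ffunP/(_ (conf A S)).
have uB b : (u, b) \notin conf A S by rewrite inE /= (negbTE uA).
have wB b : (w, b) \notin conf A S by rewrite inE /= (negbTE wA).
have uwA : u \notin w |: A by rewrite in_setU1 negb_or uw.
have wuA : w \notin u |: A by rewrite in_setU1 negb_or eq_sym uw.
have E1 : (w, true) |: ((u, false) |: conf A S) = conf (u |: (w |: A)) (u |: S).
  rewrite -(conf_setU1 _ false uA) -(conf_setU1 _ true wuA) setUCA; congr conf.
  by apply/setDidPl; rewrite disjoint_sym disjoints1 in_setU1 negb_or eq_sym uw.
have E2 : (u, true) |: ((w, false) |: conf A S) = conf (u |: (w |: A)) (w |: S).
  rewrite -(conf_setU1 _ false wA) -(conf_setU1 _ true uwA); congr conf.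
  by apply/setDidPl; rewrite disjoint_sym disjoints1 in_setU1 negb_or uw.
rewrite !ffunE !in_setU1 !(negbTE (uB _)) !(negbTE (wB _)) !xpair_eqE /= !andbF /=.
rewrite E1 E2 !jw_signU1 // !jw_sign_mode // !mode_before // 1?eq_sym //.
set a := jw_sign _ _ _; set b := jw_sign _ _ _.
have -> : (-1) ^+ (enum_rank w < enum_rank u)%N = - (-1) ^+ (enum_rank u < enum_rank w)%N :> R[i].
  by have := before_swap R (s := (w, true)) (r := (u, true));
  rewrite !mode_before // 1?eq_sym // xpair_eqE andbT => /(_ uw).
set e := (-1) ^+ _; rewrite !mulNr !mulrN opprK !mulrA.
have -> : b * e * a = a * e * b by rewrite mulrAC [b * a]mulrC mulrAC.
by apply: mulfI; rewrite !mulf_neq0 ?jw_sign_neq0 // /e signr_eq0.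
Qed.

End SpinSymmetry.

(** * Connected components *)

Section Components.
Variables (R : realType) (L V : finType) (phi : V -> L -> R) (A : {set V}).
Implicit Types (u w : V) (S K : {set V}).

Local Notation rel_A := (conn_rel phi A).
Local Notation comps_A := (comps phi A).

Lemma conn_rel_sym : connect_sym rel_A.
Proof.
apply: sym_connect_sym => u w; rewrite /conn_rel andbCA; congr [&& _, _ & _].
by apply: eq_existsb => x; rewrite mulrC.
Qed.

Lemma component_sub u : u \in A -> component phi A u \subset A.
Proof.
move=> uA; apply/subsetP => w; rewrite inE => /connectP[p].
elim: p u uA => [|x p IH] u uA /=; first by move=> _ ->.
by case/andP => /and3P[_ xA _]; exact: IH.
Qed.

Lemma comps_sub K : K \in comps_A -> K \subset A.
Proof. by case/imsetP => u uA ->; exact: component_sub. Qed.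

Lemma mem_component u : u \in component phi A u.
Proof. by rewrite inE connect0. Qed.

Lemma component_comps u : u \in A -> component phi A u \in comps_A.
Proof. exact: imset_f. Qed.

Lemma comps_component K u : K \in comps_A -> u \in K -> K = component phi A u.
Proof.
case/imsetP => w _ ->; rewrite inE => wu; apply/setP => x; rewrite !inE.
by rewrite (same_connect conn_rel_sym wu).
Qed.

Lemma comps_eq K K' u : K \in comps_A -> K' \in comps_A -> u \in K -> u \in K' -> K = K'.
Proof. by move=> KA K'A /(comps_component KA) -> /(comps_component K'A) ->. Qed.

(** An index of [A] that is nonzero on a site of [K] is directly connected to a member of [K], hence
    belongs to [K]. So distinct components occupy disjoint sites. *)
Lemma comps_sites K u x : K \in comps_A -> u \in A -> u \notin K -> x \in sites phi K ->
  phi u x = 0.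
Proof.
move=> KA uA uK; rewrite inE => /existsP[w /andP[wK wx]].
apply/eqP; apply: contraNT uK => ux; rewrite (comps_component KA wK) inE.
apply: connect1; rewrite /conn_rel (subsetP (comps_sub KA) _ wK) uA /=.
by apply/existsP; exists x; rewrite mulf_neq0.
Qed.

Lemma card_swap S K u w : u \in S -> w \notin S -> (u \in K) = (w \in K) ->
  #|(w |: S :\ u) :&: K| = #|S :&: K|.
Proof.
move=> uS wS; case: (boolP (w \in K)) => wK uK.
  have -> : (w |: S :\ u) :&: K = w |: (S :&: K) :\ u.
    apply/setP => x; rewrite !inE; case: (eqVneq x w) => [->|_] //=.
    by rewrite andbA.
  rewrite cardsU1 !inE (negbTE wS) !andbF /= [RHS](cardsD1 u) !inE uS uK.
  by [].
apply: eq_card => x; rewrite !inE; case: (eqVneq x w) => [->|_] /=.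
  by rewrite (negbTE wK) andbF.
by case: (eqVneq x u) => [->|_] //=; rewrite uK andbF.
Qed.

Variables (T : Type) (g : {set V} -> T).
Hypothesis g_swap : forall S u w, S \subset A -> u \in S -> w \in A -> w \notin S ->
  dconn phi u w -> g S = g (w |: S :\ u).

(** A down spin is carried along a path by exchanges between neighbours; indistinguishability of the
    down spins handles occupied vertices. *)
Lemma swap_path p u S : path rel_A u p -> S \subset A -> u \in S -> last u p \notin S ->
  g S = g (last u p |: S :\ u).
Proof.
elim: p u S => [|x p IH] u S /=; first by move=> _ _ ->.
case/andP => /and3P[uA xA ux] xp SA uS; set l := last x p => lS.
have lA : l \in A.
  have : l \in component phi A x by rewrite inE; apply/connectP; exists p.
  exact/subsetP/component_sub.
have lu : l != u by apply: contraNneq lS => ->.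
(* If [x] already carries a down spin, that spin is first moved on to the end of the path, and the
   one at [u] then takes its place; otherwise the spin at [u] moves to [x] and continues from
   there. *)
case: (boolP (x \in S)) => xS.
  rewrite (IH x S) // -/l; have [-> //|xu] := eqVneq x u.
  have xl : x != l by apply: contraNneq lS => <-.
  rewrite (g_swap (u := u) (w := x)) //.
  - congr g; apply/setP => y; rewrite !inE.
    case: (eqVneq y x) => [->|_]; first by rewrite xu xS orbT.
    by case: (eqVneq y u) => [->|_] //=; rewrite eq_sym (negbTE lu).
  - rewrite subUset sub1set lA; exact: subset_trans (subsetDl _ _) SA.
  - by rewrite !inE uS [u == x]eq_sym xu orbT.
  - by rewrite !inE (negbTE xl) eqxx.
rewrite (g_swap SA uS xA xS ux); have [<- //|xl] := eqVneq x l.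
rewrite (IH x) // -/l.
- congr g; apply/setP => y; rewrite !inE.
  by case: (eqVneq y x) => [->|_] //=; rewrite (negbTE xS) andbF.
- rewrite subUset sub1set xA; exact: subset_trans (subsetDl _ _) SA.
- by rewrite !inE eqxx.
- by rewrite !inE [_ == x]eq_sym (negbTE xl) (negbTE lS) andbF.
Qed.

(** Induction on the size of [S :\: S']. For [u] in this difference, equality of the counts in its
    component supplies a [w] of [S'] outside [S] in the same component, and moving [u] to [w]
    shrinks the difference. When it is empty, equal counts turn the inclusion into equality. *)
Lemma eq_of_comp_cards S S' : S \subset A -> S' \subset A ->
  (forall K, K \in comps_A -> #|S :&: K| = #|S' :&: K|) -> g S = g S'.
Proof.
move: {2}#|S :\: S'| (erefl #|S :\: S'|) => n.
elim: n S => [|n IH] S Sn SA S'A cardSS'.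
  congr g; have SS' : S \subset S' by rewrite -setD_eq0 -cards_eq0 Sn.
  apply/eqP; rewrite eqEsubset SS'; apply/subsetP => u uS'.
  have uA := subsetP S'A _ uS'; have KA := component_comps uA.
  have : S :&: component phi A u == S' :&: component phi A u.
    by rewrite eqEcard setSI //= cardSS' ?leqnn.
  by move=> /eqP/setP/(_ u); rewrite !inE uS' connect0 !andbT.
have /set0Pn[u] : S :\: S' != set0 by rewrite -card_gt0 Sn.
rewrite inE => /andP[uS' uS]; have uA := subsetP SA _ uS.
set K := component phi A u; have KA : K \in comps_A := component_comps uA.
have /existsP[w /and3P[wS' wS wK]] : [exists w, [&& w \in S', w \notin S & w \in K]].
  apply: contraNT uS'; rewrite negb_exists => /forallP H.
  have : S' :&: K == S :&: K.
    rewrite eqEcard cardSS' // leqnn andbT; apply/subsetP => w; rewrite !inE => /andP[wS' wK].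
    by have := H w; rewrite wS' inE wK andbT negbK /= => ->.
  by move=> /eqP/setP/(_ u); rewrite !inE uS connect0 !andbT.
have wA := subsetP S'A _ wS'.
have -> : g S = g (w |: S :\ u).
  by move: (wK); rewrite inE => /connectP[p up E]; rewrite E; apply: swap_path; rewrite -?E.
apply: IH => //.
- have -> : (w |: S :\ u) :\: S' = (S :\: S') :\ u.
    apply/setP => y; rewrite !inE; case: (eqVneq y w) => [->|_] /=; first by rewrite wS' andbF.
    by rewrite andbCA.
  by move: Sn; rewrite (cardsD1 u) !inE uS' uS => -[].
- rewrite subUset sub1set wA; exact: subset_trans (subsetDl _ _) SA.
- move=> K' K'A; rewrite -cardSS' // card_swap //.
  apply/idP/idP => H.
    by rewrite -(comps_eq KA K'A (mem_component u) H).
  by rewrite -(comps_eq KA K'A wK H) mem_component.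
Qed.

End Components.

(** * Action of the lowering operators *)

Section Lowering.
Variables (R : realType) (L V : finType) (phi : V -> L -> R).
Implicit Types (u : V) (A S K : {set V}) (v : fock R L).

Lemma Sminus_is_linear K : linear (@Sminus R L V phi K).
Proof.
move=> a v w; rewrite /Sminus scaler_sumr -big_split; apply: eq_bigr => x _ /=.
by rewrite [cann _ _]linearP [LHS]linearP.
Qed.
HB.instance Definition _ K :=
  GRing.isLinear.Build R[i] (fock R L) (fock R L) *:%R (Sminus phi K) (Sminus_is_linear K).

Lemma Sminus_adag_down K u v :
  Sminus phi K (adag phi u false v) = adag phi u false (Sminus phi K v).
Proof.
rewrite /Sminus [RHS]linear_sum; apply: eq_bigr => x _ /=.
by rewrite cann_adag mulr0 scale0r sub0r [LHS]linearN /= cdag_adag opprK.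
Qed.

(** The commutator is [adag phi u false] restricted to the sites of [K]. That is the whole operator
    if [u] lies in [K], and zero by [comps_sites] otherwise. *)
Lemma Sminus_adag_up A K u v : K \in comps phi A -> u \in A ->
  Sminus phi K (adag phi u true v)
  = (u \in K)%:R *: adag phi u false v + adag phi u true (Sminus phi K v).
Proof.
move=> KA uA; have -> : adag phi u true (Sminus phi K v)
    = \sum_(x in sites phi K) adag phi u true (cdag (x, false) (cann (x, true) v)).
  by rewrite /Sminus linear_sum.
rewrite /Sminus.
rewrite (eq_bigr (fun x => toC (phi u x) *: cdag (x, false) v
    + adag phi u true (cdag (x, false) (cann (x, true) v)))) => [|x _]; last first.
  by rewrite cann_adag mulr1 [LHS]linearB /= [cdag _ (_ *: _)]linearZ /= cdag_adag opprK.
rewrite big_split /=; congr (_ + _); case: (boolP (u \in K)) => uK.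
  rewrite scale1r /adag [RHS](bigID (mem (sites phi K))) /= [X in _ = _ + X]big1 ?addr0 //.
  move=> x xK; have -> : phi u x = 0; last by rewrite toC0 scale0r.
  by apply/eqP; apply: contraNT xK => ux; rewrite inE; apply/existsP; exists u; rewrite uK.
by rewrite scale0r big1 // => x xK; rewrite (comps_sites KA uA uK xK) toC0 scale0r.
Qed.

Definition spin_word (l : seq V) S : fock R L :=
  foldr (fun u w => adag phi u (u \notin S) w) (vacuum R L) l.

Lemma spin_word_cons u l S :
  spin_word (u :: l) S = adag phi u (u \notin S) (spin_word l S).
Proof. by []. Qed.

Lemma spin_word_nil S : spin_word [::] S = vacuum R L.
Proof. by []. Qed.

Opaque spin_word.

Lemma spin_word_setU1 l u S : u \notin l -> spin_word l (u |: S) = spin_word l S.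
Proof.
elim: l => [|w l IH]; first by [].
rewrite inE negb_or => /andP[uw /IH E].
by rewrite !spin_word_cons E in_setU1 [w == u]eq_sym (negbTE uw).
Qed.

Lemma Sminus_vacuum K : Sminus phi K (vacuum R L) = 0.
Proof. by rewrite /Sminus big1 // => x _; rewrite cann_vacuum linear0. Qed.

(** By the two commutation rules [Sminus] acts as a derivation, turning each up spin of [K] down in
    turn; creation operators keep their places, so no signs appear. *)
Lemma Sminus_spin_word A K l S : K \in comps phi A -> {subset l <= A} -> uniq l ->
  Sminus phi K (spin_word l S)
  = \sum_(u <- l | (u \in K) && (u \notin S)) spin_word l (u |: S).
Proof.
move=> KA; elim: l => [|u l IH] lA; first by rewrite big_nil spin_word_nil Sminus_vacuum.
case/andP => ul l_uniq; rewrite big_cons.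
have {}IH := IH (fun x xl => lA x (mem_behead (s := u :: l) xl)) l_uniq.
have tailE b : adag phi u b (Sminus phi K (spin_word l S))
    = \sum_(w <- l | (w \in K) && (w \notin S)) adag phi u b (spin_word l (w |: S)).
  by rewrite IH linear_sum.
have wu w : w \in l -> (u == w) = false by move=> wl; apply: contraNF ul => /eqP ->.
have headE b : u \notin S = b ->
    \sum_(w <- l | (w \in K) && (w \notin S)) spin_word (u :: l) (w |: S)
    = \sum_(w <- l | (w \in K) && (w \notin S)) adag phi u b (spin_word l (w |: S)).
  move=> <-; rewrite [LHS]big_seq_cond [RHS]big_seq_cond; apply: eq_bigr => w /andP[wl _].
  by rewrite spin_word_cons in_setU1 wu.
have [S1 ES1] : exists S1, S1 = u |: S by exists (u |: S).
have uS1 : u \in S1 by rewrite ES1 setU11.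
have spinS1 : spin_word l S1 = spin_word l S by rewrite ES1; exact: spin_word_setU1.
rewrite -ES1; case: (boolP (u \in S)) => uS.
  have E := etrans (headE false (negbF uS)) (esym (tailE false)).
  by rewrite andbF E spin_word_cons uS Sminus_adag_down.
have E := etrans (headE true uS) (esym (tailE true)).
have uA : u \in A by rewrite lA ?mem_head.
rewrite E andbT !spin_word_cons uS uS1 spinS1 (Sminus_adag_up _ KA uA).
by case: (u \in K); [rewrite scale1r | rewrite scale0r add0r].
Qed.

(** * The states [PhiA] as superpositions with prescribed component counts *)

Variable A : {set V}.

Definition superpose (h : {set V} -> R[i]) : fock R L :=
  \sum_(S : {set V} | S \subset A) h S *: spin_word (enum A) S.

Lemma eq_superpose h h' : (forall S, S \subset A -> h S = h' S) -> superpose h = superpose h'.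
Proof. by move=> hh'; apply: eq_bigr => S SA; rewrite hh'. Qed.

Lemma Sminus_superpose K h : K \in comps phi A ->
  Sminus phi K (superpose h) = superpose (fun S => \sum_(u in S :&: K) h (S :\ u)).
Proof.
move=> KA; rewrite /superpose linear_sum /=.
under eq_bigr => S SA.
  rewrite linearZ /= (Sminus_spin_word _ KA) ?enum_uniq //; last by move=> x; rewrite mem_enum.
  rewrite big_enum_cond scaler_sumr; over.
under [RHS]eq_bigr => S SA do rewrite scaler_suml.
rewrite [LHS](exchange_big_dep (fun u => u \in K)) /=; last by move=> S u _ /and3P[].
rewrite [RHS](exchange_big_dep (fun u => u \in K)) /=; last by move=> S u _; rewrite inE => /andP[].
apply: eq_bigr => u uK; have uA := subsetP (comps_sub KA) _ uK.
(* For fixed [u], source sets without [u] correspond to target sets with [u]. *)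
rewrite [RHS](reindex_onto (fun S => u |: S) (fun S => S :\ u)) /=; last first.
  by move=> S /andP[_]; rewrite inE => /andP[uS _]; rewrite setD1K.
apply: eq_big => [S|S].
  rewrite uK uA /= subUset sub1set uA inE setU11 uK /= andbT.
  case: (boolP (S \subset A)) => //= _; apply/idP/eqP => [uS|<-]; first exact: setU1K.
  by rewrite !inE eqxx.
by case/and4P => _ _ _ uS; rewrite setU1K.
Qed.

(* The factorials count the orders in which [Sminus] can produce a given set of down spins. *)
Definition profile (m : {set V} -> nat) (S : {set V}) : R[i] :=
  (\prod_(K in comps phi A) (m K)`!)%:R * [forall K in comps phi A, #|S :&: K| == m K]%:R.

Lemma eq_profile m m' S : {in comps phi A, m =1 m'} -> profile m S = profile m' S.
Proof.
move=> mm'; rewrite /profile; congr (_%:R * _%:R); first by apply: eq_bigr => K /mm' ->.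
by congr (nat_of_bool _); apply: eq_forallb_in => K /mm' ->.
Qed.

(** Removing [u] from [S] lowers only the count of its own component [K]. When the counts match, the
    sum has [m K + 1] equal terms, which turns the factorial of [m K] into that of [m K + 1]. *)
Lemma profile_step m K S : K \in comps phi A -> S \subset A ->
  \sum_(u in S :&: K) profile m (S :\ u) = profile (fun K' => m K' + (K' == K))%N S.
Proof.
move=> KA SA; set m' := fun K' : {set V} => _.
have stepE u : u \in S :&: K -> [forall K' in comps phi A, #|(S :\ u) :&: K'| == m K']
    = [forall K' in comps phi A, #|S :&: K'| == m' K'].
  rewrite inE => /andP[uS uK]; apply: eq_forallb_in => K' K'A.
  rewrite /m' setIDAC [#|S :&: K'|](cardsD1 u) inE uS /= addnC.
  have -> : (u \in K') = (K' == K).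
    apply/idP/eqP => [uK'|-> //]; exact: comps_eq K'A KA uK' uK.
  by rewrite eqn_add2r.
rewrite (eq_bigr (fun=> (\prod_(K' in comps phi A) (m K')`!)%:R *
    [forall K' in comps phi A, #|S :&: K'| == m' K']%:R)); last first.
  by move=> u /stepE E; rewrite /profile E.
rewrite sumr_const /profile; case: (boolP [forall _ in _, _]) => [/forall_inP/(_ K KA)/eqP SK|_].
  rewrite !mulr1 -[LHS]mulr_natl -natrM SK; congr (_%:R).
  rewrite (bigD1 K) //= [RHS](bigD1 K) //= /m' eqxx addn1 factS mulnA; congr (_ * _)%N.
  by apply: eq_bigr => K' /andP[_ /negbTE ->]; rewrite addn0.
by rewrite !mulr0 mul0rn.
Qed.

Lemma iter_Sminus_profile n m K : K \in comps phi A ->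
  iter n (Sminus phi K) (superpose (profile m))
  = superpose (profile (fun K' => m K' + n * (K' == K))%N).
Proof.
move=> KA; elim: n => [|n IH] /=.
  by apply: eq_superpose => S _; apply: eq_profile => K' _; rewrite mul0n addn0.
rewrite IH (Sminus_superpose _ KA); apply: eq_superpose => S SA.
rewrite profile_step //; apply: eq_profile => K' _.
by rewrite mulSn -addnA [(n * _ + _)%N]addnC.
Qed.

(** The fully polarised state is the profile with all counts zero, and each block of lowering
    operators raises one count from zero to [j K]. Hence all spin configurations with the prescribed
    counts appear with equal weight. *)
Lemma PhiA_superpose (j : {set V} -> nat) : PhiA phi A j = superpose (profile j).
Proof.
rewrite /PhiA; set base := foldr _ _ (enum A).
have baseE : base = superpose (profile (fun=> 0%N)).
  rewrite /superpose (bigD1 set0) ?sub0set //= big1 ?addr0 => [|S /andP[SA S0]].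
    rewrite /profile big1 // mul1r.
    have -> : [forall K in comps phi A, #|set0 :&: K| == 0%N].
      by apply/forall_inP => K _; rewrite set0I cards0.
    rewrite scale1r /base; elim: (enum A) => [|u l IH]; first by rewrite spin_word_nil.
    by rewrite spin_word_cons inE -IH.
  (* The components cover [A], so a nonempty [S] meets one of them. *)
  rewrite /profile; have -> : [forall K in comps phi A, #|S :&: K| == 0%N] = false.
    have /set0Pn[u uS] := S0; apply/negbTE/forall_inPn.
    exists (component phi A u); first exact/component_comps/(subsetP SA).
    by rewrite cards_eq0; apply/set0Pn; exists u; rewrite inE uS mem_component.
  by rewrite mulr0 scale0r.
(* Generalised to partial lists of components: those not yet treated still have count zero. *)
have foldE l : {subset l <= comps phi A} -> uniq l ->
    foldr (fun K w => iter (j K) (Sminus phi K) w) base l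
    = superpose (profile (fun K => if K \in l then j K else 0%N)).
  elim: l => [|K l IH] lA /=.
    by rewrite baseE.
  case/andP => Kl l_uniq; have KA : K \in comps phi A by apply: lA; exact: mem_head.
  have lA' : {subset l <= comps phi A} by move=> x xl; apply: lA; rewrite inE xl orbT.
  rewrite (IH lA' l_uniq) (iter_Sminus_profile _ _ KA); apply: eq_superpose => S _.
  apply: eq_profile => K' _; rewrite inE; case: eqVneq => [->|_] /=.
    by rewrite (negbTE Kl) muln1.
  by rewrite muln0 addn0.
have enumA : {subset enum (comps phi A) <= comps phi A} by move=> K; rewrite mem_enum.
rewrite (foldE _ enumA (enum_uniq _)).
by apply: eq_superpose => S _; apply: eq_profile => K KA; rewrite mem_enum KA.
Qed.

End Lowering.

(** * Ground states *)

Section SpinExpansion.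
Variables (R : realType) (L V : finType) (phi : V -> L -> R) (site : V -> L).
Variable f : fock R V.
Implicit Types (u w : V) (A S : {set V}) (B : {set mode V}).

Hypothesis site_neq0 : forall u, phi u (site u) != 0.
Hypothesis site_eq0 : forall u u', u' != u -> phi u' (site u) = 0.
Hypothesis phi_le2 : condB2 phi.
Hypothesis f_pair : forall x,
  \sum_u \sum_u' (toC (phi u x) * toC (phi u' x)) *: cann (u', false) (cann (u, true) f) = 0.

Let f_double u (B : {set mode V}) : (u, true) \in B -> (u, false) \in B -> f B = 0.
Proof. exact: (double_eq0 site_neq0 site_eq0 f_pair). Qed.

Lemma conf_swap A S u w : S \subset A -> u \in S -> w \in A -> w \notin S ->
  dconn phi u w -> f (conf A S) = f (conf A (w |: S :\ u)).
Proof.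
move=> SA uS wA wS uw; have uA := subsetP SA _ uS.
have uw' : u != w by apply: contraNneq wS => <-.
have EA : A = u |: (w |: (A :\ u) :\ w) by rewrite setD1K ?setD1K // !inE eq_sym uw'.
rewrite EA -{1}(setD1K uS).
by apply: (exchange_conf site_neq0 site_eq0 phi_le2 f_pair);
  rewrite // !inE ?eqxx ?andbF // (negbTE wS) andbF.
Qed.

Definition occupied (B : {set mode V}) : {set V} := [set s.1 | s in B].
Definition downs (B : {set mode V}) : {set V} := [set u | (u, false) \in B].

Lemma downs_sub (B : {set mode V}) : downs B \subset occupied B.
Proof. by apply/subsetP => u; rewrite inE => uB; apply/imsetP; exists (u, false). Qed.

Lemma conf_occupied (B : {set mode V}) : (forall u, ~~ (((u, true) \in B) && ((u, false) \in B))) ->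
  conf (occupied B) (downs B) = B.
Proof.
move=> Bs; apply/setP => -[u b]; rewrite !inE /=; have := Bs u.
have -> : (u \in occupied B) = ((u, true) \in B) || ((u, false) \in B).
  apply/imsetP/orP => [[[w [|]] wB /= ->]|[|] uB]; [by left|by right| |].
  - by exists (u, true).
  - by exists (u, false).
by case: b; case: ((u, true) \in B); case: ((u, false) \in B).
Qed.

Lemma occupied_conf A S : S \subset A -> occupied (conf A S) = A.
Proof.
move=> SA; apply/setP => u; apply/imsetP/idP => [[s]|uA]; first by rewrite inE => /andP[sA _] ->.
by exists (u, u \notin S); rewrite ?inE //= uA eqxx.
Qed.

Lemma downs_conf A S : S \subset A -> downs (conf A S) = S.
Proof.
move=> SA; apply/setP => u; rewrite !inE /= eq_sym eqbF_neg negbK andb_idl //.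
exact: subsetP.
Qed.

Lemma conf_no_double A S u :
  ~~ (((u, true) \in conf A S) && ((u, false) \in conf A S)).
Proof. by rewrite !inE /=; case: (u \in A); case: (u \in S). Qed.

Lemma word_conf A S : word phi (enum (conf A S)) = spin_word phi (enum A) S.
Proof.
rewrite enum_conf; elim: (enum A) => [|u l IH]; first by rewrite spin_word_nil.
by rewrite spin_word_cons -IH.
Qed.

(** [f] vanishes on doubly occupied configurations, and on the others [occupied] and [downs] invert
    [conf]. *)
Lemma embed_conf : embed phi f = \sum_A superpose phi A (fun S => f (conf A S)).
Proof.
pose P (B : {set mode V}) := [forall u, ~~ (((u, true) \in B) && ((u, false) \in B))].
rewrite /embed (bigID P) /= [X in _ + X]big1 ?addr0; last first.
  move=> B; rewrite negb_forall => /existsP[u]; rewrite negbK => /andP[uB1 uB2].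
  by rewrite (f_double uB1 uB2) scale0r.
rewrite (reindex_onto (fun p : {set V} * {set V} => conf p.1 p.2)
  (fun B => (occupied B, downs B))) /=; last first.
  by move=> B /forallP; exact: conf_occupied.
rewrite /superpose pair_big_dep /=; apply: eq_big => [[A S]|[A S] _] /=; last first.
  by rewrite word_conf.
have -> : P (conf A S) by apply/forallP => u; exact: conf_no_double.
apply/eqP/idP => [[EA ES]|SA]; first by have := downs_sub (conf A S); rewrite EA ES.
by rewrite occupied_conf ?downs_conf.
Qed.

(** A [jtype] assigns numbers to all subsets of [V]; the value zero outside the components of [A]
    fixes one canonical choice. *)
Definition comp_counts A S : jtype V :=
  [ffun K => inord (if K \in comps phi A then #|S :&: K| else 0%N)].

Lemma comp_countsE A S K :
  comp_counts A S K = (if K \in comps phi A then #|S :&: K| else 0%N) :> nat.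
Proof.
rewrite ffunE inordK // ltnS; case: ifP => // _; exact: max_card.
Qed.

(** By the exchange symmetry [f (conf A S)] depends only on the component counts of [S], so the sum
    over [S] can be grouped by these counts. *)
Lemma superpose_conf_span A : exists coef : jtype V -> R[i],
  superpose phi A (fun S => f (conf A S))
  = \sum_(j | admissible phi A j) coef j *: PhiA phi A (fun K => nat_of_ord (j K)).
Proof.
(* A spin set with counts [j]; the default occurs only when there is none. *)
pose rep (j : jtype V) := odflt set0 [pick S : {set V} |
  (S \subset A) && [forall K in comps phi A, #|S :&: K| == j K]].
(* Different [j] agreeing on the components give the same state, so only the canonical one gets
   weight. The division cancels the factorials in [profile]. *)
pose coef (j : jtype V) : R[i] := if [forall K, (K \notin comps phi A) ==> (j K == 0%N :> nat)]
  then f (conf A (rep j)) / (\prod_(K in comps phi A) (j K)`!)%:R else 0.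
exists coef.
have -> : \sum_(j | admissible phi A j) coef j *: PhiA phi A (fun K => nat_of_ord (j K))
    = superpose phi A (fun S => \sum_(j | admissible phi A j)
        coef j * profile phi A (fun K => nat_of_ord (j K)) S).
  under eq_bigr => j _.
    rewrite PhiA_superpose /superpose scaler_sumr.
    under eq_bigr => S _ do rewrite scalerA.
    over.
  rewrite exchange_big /superpose; apply: eq_bigr => S _.
  by rewrite scaler_suml.
apply: eq_superpose => S SA.
have adm : admissible phi A (comp_counts A S).
  by apply/forall_inP => K KA; rewrite comp_countsE KA subset_leq_card // subsetIr.
rewrite (bigD1 (comp_counts A S)) //= big1 ?addr0 => [|j /andP[_ jS]]; last first.
  rewrite /coef; case: ifP => [/forallP j0|_]; last by rewrite mul0r.
  rewrite /profile; case: (boolP [forall K in comps phi A, _]) => [/forall_inP jE|_];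
    last by rewrite !mulr0.
  case/eqP: jS; apply/ffunP => K; apply: val_inj; rewrite /= comp_countsE.
  case: ifPn => KA; first by rewrite (eqP (jE K KA)).
  by have := j0 K; rewrite KA => /eqP.
rewrite /coef /profile ifT; last first.
  by apply/forallP => K; apply/implyP => /negbTE KA; rewrite comp_countsE KA.
have -> : [forall K in comps phi A, #|S :&: K| == comp_counts A S K].
  by apply/forall_inP => K KA; rewrite comp_countsE KA.
rewrite mulr1 divfK; last first.
  by rewrite pnatr_eq0 -lt0n prodn_cond_gt0 // => K _; exact: fact_gt0.
rewrite /rep; case: pickP => [S' /andP[S'A /forall_inP S'E] /=|/(_ S)]; last first.
  by rewrite SA => /forall_inP[] K KA; rewrite comp_countsE KA.
apply: (eq_of_comp_cards (phi := phi) (A := A) (g := fun S => f (conf A S))) => //.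
  by move=> S1 u w; exact: conf_swap.
by move=> K KA; rewrite (eqP (S'E K KA)) comp_countsE KA.
Qed.

Lemma embed_span n : in_sector n f -> in_span_Phi phi n (embed phi f).
Proof.
move=> /in_sectorP fn.
have /fin_all_exists[coef coefE] := superpose_conf_span.
exists coef; rewrite embed_conf (bigID (fun A : {set V} => #|A| == n)) /=.
rewrite [X in _ + X]big1 ?addr0 => [|A An]; first by apply: eq_bigr => A _; exact: coefE.
rewrite /superpose big1 // => S _; suff -> : f (conf A S) = 0 by rewrite scale0r.
by apply/eqP; apply: contraNT An => /fn; rewrite card_conf => ->.
Qed.

(** A configuration on which [f] is nonzero has at most one particle per index of [V]. *)
Lemma card_sector n : f != 0 -> in_sector n f -> (n <= #|V|)%N.
Proof.
move=> f0 /in_sectorP fn.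
have [B fB] : exists B, f B != 0.
  apply/existsP; apply: contraNT f0; rewrite negb_exists => /forallP f0.
  by apply/eqP/ffunP => B; rewrite ffunE; have /negPn/eqP := f0 B.
have Bs u : ~~ (((u, true) \in B) && ((u, false) \in B)).
  by apply: contraNN fB => /andP[uB1 uB2]; rewrite (f_double uB1 uB2).
by rewrite -(fn _ fB) -(conf_occupied Bs) card_conf max_card.
Qed.

End SpinExpansion.

(** * Minimal states and conclusion *)

Section GroundStates.
Variables (R : realType) (L V : finType) (t : L -> L -> R) (U : L -> R) (eps0 : R).
Variables (phi : V -> L -> R) (site : V -> L).
Implicit Types (v : fock R L).

Hypothesis t_sym : forall x y, t x y = t y x.
Hypothesis U_gt0 : forall x, 0 < U x.
Hypothesis eps0_min : forall e, is_eigval_t t e -> eps0 <= e.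
Hypothesis phi_eig : forall u, in_H0 t eps0 (fun x => toC (phi u x)).
Hypothesis phi_complete : forall psi : L -> R[i], in_H0 t eps0 psi ->
  exists a : V -> R[i], forall x, psi x = \sum_(u : V) a u * toC (phi u x).
Hypothesis site_neq0 : forall u, phi u (site u) != 0.
Hypothesis site_eq0 : forall u u', u' != u -> phi u' (site u) = 0.

(** This is the equality case of [eigenvalue_bound]: vanishing defects make [v] flat, hence an
    embedded state, and vanishing interaction energy gives the pair relation. *)
Lemma minimal_state_embed n v : v != 0 -> in_sector n v ->
  hubbardH t U v = toC (n%:R * eps0) *: v ->
  exists f : fock R V, [/\ v = embed phi f, in_sector n f & forall x,
    \sum_u \sum_u' (toC (phi u x) * toC (phi u' x)) *: cann (u', false) (cann (u, true) f) = 0].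
Proof.
move=> v0 vn Hv; have [_ /esym] := eigenvalue_bound t_sym U_gt0 eps0_min v0 vn Hv.
rewrite eqxx => /andP[/eqP defect0 /eqP double0].
have vF : flat t eps0 v := dot_cdag_defect_eq0 t_sym eps0_min defect0.
have vB := dot_double_occ_eq0 U_gt0 double0.
have [f vE] := embed_surj phi_complete site_neq0 site_eq0 vF vn.
exists f; subst v; split=> //.
  exact: (embed_sector phi_complete site_neq0 site_eq0 vF vn).
by move=> x; exact: (embed_pair phi_complete site_neq0 site_eq0 vF (vB x)).
Qed.

Lemma flat_spin_word l S : flat t eps0 (spin_word phi l S).
Proof.
elim: l => [|u l IH]; first by rewrite spin_word_nil; exact: flat_vacuum.
by rewrite spin_word_cons; exact: flat_adag.
Qed.

Lemma cann_down_spin_word x l : cann (x, false) (spin_word phi l set0) = 0.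
Proof.
elim: l => [|u l IH]; first by rewrite spin_word_nil cann_vacuum.
by rewrite spin_word_cons inE cann_adag IH linear0 mulr0 scale0r subr0.
Qed.

(** With all spins up the interaction term vanishes, and a word in the [adag] is flat, so the bound
    is attained; injectivity of [embed] shows that the state is nonzero. *)
Lemma polarized_state (A : {set V}) : let v := spin_word phi (enum A) set0 in
  [/\ v != 0, in_sector #|A| v & hubbardH t U v = toC (#|A|%:R * eps0) *: v].
Proof.
move=> v; set f := basis_vec R (conf A set0).
have vE : v = embed phi f.
  rewrite /v -word_conf /embed (bigD1 (conf A set0)) //= big1 => [|B BA].
    by rewrite ffunE eqxx scale1r addr0.
  by rewrite ffunE (negbTE BA) scale0r.
have vF : flat t eps0 v := flat_spin_word _ _.
have vn : in_sector #|A| v.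
  have fn : in_sector #|A| f.
    apply/in_sectorP => B; rewrite ffunE.
    by case: (eqVneq B (conf A set0)) => [-> _|_]; [exact: card_conf | rewrite eqxx].
  rewrite /in_sector vE (Nop_embed phi_complete site_neq0 site_eq0) -?vE // fn.
  by rewrite [LHS]linearZ /= -vE.
split=> //.
  apply/eqP; rewrite vE => /(embed_eq0 site_neq0 site_eq0)/ffunP/(_ (conf A set0)).
  by rewrite !ffunE eqxx => /eqP; rewrite oner_eq0.
rewrite (hubbardHE t U eps0) vn big1 ?addr0 => [|s _]; last by rewrite vF linear0.
rewrite /double_occ big1 ?addr0 => [|x _].
  by rewrite scalerA toC_natM mulrC.
by rewrite /nop cann_down_spin_word !linear0.
Qed.

Lemma gs_energy_minimal n : (n <= #|V|)%N -> gs_energy (hubbardH t U) n (n%:R * eps0).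
Proof.
move=> nV; split; last first.
  by move=> v E v0 vn Hv; have [] := eigenvalue_bound t_sym U_gt0 eps0_min v0 vn Hv.
pose A := [set u in take n (enum V)].
have An : #|A| = n.
  by rewrite cardsE (card_uniqP _) ?take_uniq ?enum_uniq // size_take -cardE; case: ltngtP nV.
by have := polarized_state A; rewrite An => H; exists (spin_word phi (enum A) set0).
Qed.

Lemma gs_energy_uniq (H : fock R L -> fock R L) n E E' :
  gs_energy H n E -> gs_energy H n E' -> E = E'.
Proof.
move=> [[v [v0 vn Hv]] Emin] [[w [w0 wn Hw]] E'min].
by apply/eqP; rewrite eq_le -!lecR (Emin _ _ w0 wn Hw) (E'min _ _ v0 vn Hv).
Qed.

End GroundStates.

Theorem theorem3p2 (R : realType) (L V : finType)
    (t : L -> L -> R) (U : L -> R) (eps0 : R) (phi : V -> L -> R) :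
  (forall x y, t x y = t y x) ->
  (forall x, 0 < U x) ->
  is_min_eigval_t t eps0 ->
  condB0 phi t eps0 -> condB1 phi -> condB2 phi ->
  (forall Ne : nat, (Ne <= #|V|)%N ->
     gs_energy (hubbardH t U) Ne (Ne%:R * eps0) /\
     forall v, is_ground_state (hubbardH t U) Ne v -> in_span_Phi phi Ne v)
  /\
  (forall Ne : nat, (#|V| < Ne)%N ->
     forall E, gs_energy (hubbardH t U) Ne E -> Ne%:R * eps0 < E).
Proof.
move=> t_sym U_gt0 [_ eps0_min] [phi_eig _ phi_complete] /fin_all_exists[site siteP] phi_le2.
have site_neq0 u : phi u (site u) != 0 by case: (siteP u).
have site_eq0 u u' : u' != u -> phi u' (site u) = 0 by case: (siteP u) => _; apply.
have embedP := minimal_state_embed t_sym U_gt0 eps0_min phi_complete site_neq0 site_eq0.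
split=> n nV.
  have gsE := gs_energy_minimal t_sym U_gt0 eps0_min phi_eig phi_complete site_neq0 site_eq0 nV.
  split=> // v [E [vE [v0 vn Hv]]]; move: Hv; rewrite (gs_energy_uniq vE gsE) => Hv.
  have [f [-> fn fp]] := embedP n v v0 vn Hv.
  exact: embed_span site_neq0 site_eq0 phi_le2 fp n fn.
move=> E [[v [v0 vn Hv]] _].
have [le_E _] := eigenvalue_bound t_sym U_gt0 eps0_min v0 vn Hv.
(* Equality would make [v] the image of a nonzero [f] with [n] particles and no doubly occupied
   index, which [card_sector] excludes for [n] larger than [#|V|]. *)
rewrite lt_neqAle -lecR le_E andbT; apply/eqP => EE; move: Hv; rewrite -EE => Hv.
have [f [vE fn fp]] := embedP n v v0 vn Hv.
have f0 : f != 0 by apply: contraNneq v0 => f0; rewrite vE f0 linear0.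
by have := card_sector site_neq0 site_eq0 fp f0 fn; rewrite leqNgt nV.
Qed.
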